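(* Let $E$ be an elliptic curve over $\mathbb{C}$ and let $\mathcal{SE}$ be the complex supermanifold of dimension $1|1$ with reduced manifold $E$ and structure sheaf $\mathcal{O}_{\mathcal{SE}}=\mathcal{O}_E\oplus\Pi\Theta_E$, where $\Theta_E\cong\mathcal{O}_E$ is the odd theta characteristic of $E$. Then the Hodge-to-de Rham (Frölicher) spectral sequence $E_1^{p,q}=\check{H}^q(\mathcal{SE},\Omega^p_{\mathcal{SE},odd})$ of $\mathcal{SE}$ does not converge at page one: for each of $q=0$ and $q=1$ there are infinitely many $p$ for which the differential $d_1:E_1^{p,q}\to E_1^{p+1,q}$ is non-zero. It converges at page two, i.e. $E_2=E_\infty$. In particular, the Hodge-to-de Rham spectral sequence of a complex supermanifold with Kähler reduced manifold does not in general converge at page one.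
   Context: $\Pi$ is the parity-change functor; a theta characteristic of $E$ is an invertible sheaf $\Theta_E$ with $\Theta_E^{\otimes 2}\cong\mathcal{K}_E$ (the canonical sheaf), and the unique odd one (with $h^0(E,\Theta_E)=1$) on an elliptic curve is $\mathcal{O}_E$. Multiplication in $\mathcal{O}_{\mathcal{SE}}$ is that of the exterior algebra of $\Theta_E$ (split supermanifold); local coordinates are $z\,|\,\theta$ with $z$ even and $\theta$ odd. For a complex supermanifold $\mathcal{M}$ with local coordinates $x_a$, $\Omega^1_{\mathcal{M},odd}$ is the sheaf of holomorphic 1-forms, a locally free sheaf of right $\mathcal{O}_{\mathcal{M}}$-modules with local basis $dx_a$ of parity $|dx_a|=|x_a|+1$; $\Omega^k_{\mathcal{M},odd}=S^k\Omega^1_{\mathcal{M},odd}$ (supersymmetric power, hence $dz$'s anticommute and $d\theta$'s commute, and $\Omega^k_{\mathcal{M},odd}$ can be non-zero for all $k\geq0$); $d$ is the exterior derivative, the odd nilpotent superderivation extending $df=\sum_a dx_a\,\partial_{x_a}f$. The Hodge-to-de Rham spectral sequence is that of the Čech–de Rham double complex $\check{C}^\bullet(\mathcal{U},\Omega^\bullet_{\mathcal{M},odd})$ obtained by taking first cohomology with respect to the Čech differential; its first page is $E_1^{p,q}=\check H^q(\mathcal{M},\Omega^p_{\mathcal{M},odd})$ with $d_1$ induced by $d$. *)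

(* Defs.v *)
(* Stdlib / Coquelicot: C is Coquelicot's type of complex numbers *)
From Stdlib Require Import Reals List ZArith.
From Stdlib Require Import ClassicalEpsilon FunctionalExtensionality ProofIrrelevance.
From Coquelicot Require Import Coquelicot.

Set Implicit Arguments.
Unset Strict Implicit.
Unset Printing Implicit Defensive.

(* Coquelicot has no canonical abelian group structure on functions. *)
Section FunctionGroup.
Variables (T : Type) (G : AbelianGroup).

Definition fct_plus (f g : T -> G) : T -> G := fun t => plus (f t) (g t).
Definition fct_opp (f : T -> G) : T -> G := fun t => opp (f t).
Definition fct_zero : T -> G := fun _ => zero.

Lemma fct_plus_comm f g : fct_plus f g = fct_plus g f.
Proof. apply functional_extensionality; intro t; apply plus_comm. Qed.

Lemma fct_plus_assoc f g h : fct_plus f (fct_plus g h) = fct_plus (fct_plus f g) h.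
Proof. apply functional_extensionality; intro t; apply plus_assoc. Qed.

Lemma fct_plus_zero_r f : fct_plus f fct_zero = f.
Proof. apply functional_extensionality; intro t; apply plus_zero_r. Qed.

Lemma fct_plus_opp_r f : fct_plus f (fct_opp f) = fct_zero.
Proof. apply functional_extensionality; intro t; apply plus_opp_r. Qed.

Definition fct_AbelianMonoid_mixin :=
  AbelianMonoid.Mixin _ _ _ fct_plus_comm fct_plus_assoc fct_plus_zero_r.
Canonical fct_AbelianMonoid := AbelianMonoid.Pack _ fct_AbelianMonoid_mixin (T -> G).
Definition fct_AbelianGroup_mixin :=
  AbelianGroup.Mixin fct_AbelianMonoid _ fct_plus_opp_r.
Canonical fct_AbelianGroup :=
  AbelianGroup.Pack _ (AbelianGroup.Class _ _ fct_AbelianGroup_mixin) (T -> G).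

End FunctionGroup.

Definition alt (G : AbelianGroup) (n : nat) (x : G) : G :=
  if Nat.even n then x else opp x.

(** * Spectral sequence of a first-quadrant double complex

    The double complex is given inside an ambient group [W]: its (p,q) term is
    the subgroup [K p q], with commuting differentials [dh : K p q -> K p.+1 q]
    and [dv : K p q -> K p q.+1].  The filtration is by p, so that the page 0
    differential is [dv]. *)
Section SpectralSequence.
Variables (W : AbelianGroup) (K : nat -> nat -> W -> Prop) (dh dv : W -> W).

Definition Dtot (X : nat -> nat -> W) (p q : nat) : W :=
  plus (match q with O => zero | S q' => dv (X p q') end)
       (match p with O => zero | S p' => alt q (dh (X p' q)) end).

(* The degree n part of the total complex; it is 0 for n < 0. *)
Definition Tot (n : Z) (X : nat -> nat -> W) : Prop :=
  forall p q, K p q (X p q) /\ (Z.of_nat (p + q) <> n -> X p q = zero).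

Definition Fil (p : Z) (X : nat -> nat -> W) : Prop :=
  forall p' q', (Z.of_nat p' < p)%Z -> X p' q' = zero.

(* { X in F^p Tot^n : D X in F^(p+r) Tot^(n+1) } *)
Definition Asys (r : nat) (p n : Z) (X : nat -> nat -> W) : Prop :=
  Tot n X /\ Fil p X /\ Tot (n + 1) (Dtot X) /\ Fil (p + Z.of_nat r) (Dtot X).

(* Z_r and B_r are taken in gr^p Tot^(p+q) = K p q, i.e. one retains the
   (p,q) component of an element of F^p Tot^(p+q). *)
Definition Zcyc (r p q : nat) (x : W) : Prop :=
  exists X, Asys r (Z.of_nat p) (Z.of_nat (p + q)) X /\ x = X p q.

(* The components of D (A_(r-1)^(p-r+1)) in degree (p,q). *)
Definition Bbd (r p q : nat) (x : W) : Prop :=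
  exists X, Tot (Z.of_nat (p + q) - 1) X
    /\ Fil (Z.of_nat p - Z.of_nat r + 1) X
    /\ Tot (Z.of_nat (p + q)) (Dtot X)
    /\ Fil (Z.of_nat p) (Dtot X)
    /\ x = Dtot X p q.

Definition coset (B : W -> Prop) (x : W) : W -> Prop := fun y => B (minus y x).

Definition subquotient (Z B : W -> Prop) (xi : W -> Prop) : Prop :=
  exists x, Z x /\ xi = coset B x.

Definition page (r p q : nat) : (W -> Prop) -> Prop :=
  subquotient (Zcyc r p q) (Bbd r p q).

Definition page_infty (p q : nat) : (W -> Prop) -> Prop :=
  subquotient (fun x => forall r, Zcyc r p q x) (fun x => exists r, Bbd r p q x).

(* d_r : E_r^{p,q} -> E_r^{p+r,q-r+1}, [X] |-> [D X].  When q + 1 < r the target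
   is zero; the truncated index is then harmless, D X having no component of
   degree (p + r, 0). *)
Definition page_diff (r p q : nat) (xi : W -> Prop) : W -> Prop := fun y =>
  exists X, Asys r (Z.of_nat p) (Z.of_nat (p + q)) X /\ xi (X p q)
    /\ coset (Bbd r (p + r) (S q - r)) (Dtot X (p + r)%nat (S q - r)%nat) y.

Definition page_diff_nonzero (r p q : nat) : Prop :=
  exists xi, page r p q xi
    /\ page_diff r p q xi <> coset (Bbd r (p + r) (S q - r)) zero.

(* E_r = E_oo *)
Definition converges_at_page (r : nat) : Prop :=
  forall p q, page r p q = page_infty p q.

End SpectralSequence.

(** * Elliptic curves as complex tori *)

Record lattice : Type := Lattice {
  omega1 : C;
  omega2 : C;
  omega_indep : forall a b : R,
    (RtoC a * omega1 + RtoC b * omega2 = 0)%C -> a = 0%R /\ b = 0%R }.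

Definition in_lattice (L : lattice) (z : C) : Prop :=
  exists m n : Z, z = (RtoC (IZR m) * omega1 L + RtoC (IZR n) * omega2 L)%C.

(* A point of C / L is a coset of L. *)
Record elliptic_curve (L : lattice) : Type := EllipticPoint {
  point_coset : C -> Prop;
  point_cosetP : exists z, point_coset = (fun w => in_lattice L (w - z)%C) }.

Definition proj (L : lattice) (z : C) : elliptic_curve L :=
  EllipticPoint (ex_intro _ z eq_refl).

Definition lift (L : lattice) (x : elliptic_curve L) : C :=
  proj1_sig (constructive_indefinite_description _ (point_cosetP x)).

Definition open_E (L : lattice) (U : elliptic_curve L -> Prop) : Prop :=
  open (fun z : C => U (proj L z)).

Definition holomorphic_on (L : lattice) (U : elliptic_curve L -> Prop)
    (f : elliptic_curve L -> C) : Prop :=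
  forall z : C, U (proj L z) ->
    @ex_derive C_AbsRing C_NormedModule (fun w => f (proj L w)) z.

(* The derivative along the global vector field d/dz; for f holomorphic near x
   it does not depend on the lift of x. *)
Definition deriv_z (L : lattice) (f : elliptic_curve L -> C) (x : elliptic_curve L) : C :=
  C_derive (fun w => f (proj L w)) (lift x).

(** * The supermanifold SE and its differential forms

    The coordinate field d/dz trivialises the tangent bundle of E, and a
    generator theta of Theta_E = O_E is fixed, so z | theta are coordinates
    around every point, dz and d(theta) being globally defined.  A section of
    O_SE is f0 + theta f1, represented by x |-> (f0 x, f1 x). *)
Definition sfun (L : lattice) : AbelianGroup :=
  fct_AbelianGroup (elliptic_curve L) (prod_AbelianGroup C_AbelianGroup C_AbelianGroup).

Definition d_z (L : lattice) (f : sfun L) : sfun L :=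
  fun x => (deriv_z (fun y => fst (f y)) x, deriv_z (fun y => snd (f y)) x).

Definition d_theta (L : lattice) (f : sfun L) : sfun L :=
  fun x => (snd (f x), RtoC 0).

(* Omega^p = S^p Omega^1 has right O_SE-basis d(theta)^p and, if p > 0,
   dz d(theta)^(p-1), as dz is odd and d(theta) even.  The p-form
   d(theta)^p A + dz d(theta)^(p-1) B is represented by (A, B). *)
Definition form (L : lattice) : AbelianGroup := prod_AbelianGroup (sfun L) (sfun L).

(* From d(w f) = (-1)^|w| w df and df = dz d_z f + d(theta) d_theta f:
   d(d(theta)^p A) = dz d(theta)^p d_z A + d(theta)^(p+1) d_theta A,
   d(dz d(theta)^(p-1) B) = - dz d(theta)^p d_theta B. *)
Definition d_form (L : lattice) (w : form L) : form L :=
  (d_theta (fst w), minus (d_z (fst w)) (d_theta (snd w))).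

(* The products of O_SE and of the forms: theta and dz are odd, d(theta) is even,
   so that theta theta = dz dz = 0 and theta dz = - dz theta. *)
Definition sfun_mult (L : lattice) (f g : sfun L) : sfun L := fun x =>
  (fst (f x) * fst (g x), fst (f x) * snd (g x) + snd (f x) * fst (g x))%C.

Definition sfun_parity (L : lattice) (f : sfun L) : sfun L :=
  fun x => (fst (f x), - snd (f x))%C.

Definition form_mult (L : lattice) (v w : form L) : form L :=
  (sfun_mult (fst v) (fst w),
   plus (sfun_mult (sfun_parity (fst v)) (snd w)) (sfun_mult (snd v) (fst w))).

Definition form_parity (L : lattice) (w : form L) : form L :=
  (sfun_parity (fst w), opp (sfun_parity (snd w))).

Lemma is_C_derive_plus (f g : C -> C) (z l m : C) :
  @is_derive C_AbsRing C_NormedModule f z l ->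
  @is_derive C_AbsRing C_NormedModule g z m ->
  @is_derive C_AbsRing C_NormedModule (fun w => f w + g w)%C z (l + m)%C.
Proof. intros Hf Hg; exact (is_derive_plus _ _ _ _ _ Hf Hg). Qed.

Lemma is_C_derive_mult (f g : C -> C) (z l m : C) :
  @is_derive C_AbsRing C_NormedModule f z l ->
  @is_derive C_AbsRing C_NormedModule g z m ->
  @is_derive C_AbsRing C_NormedModule (fun w => f w * g w)%C z (l * g z + f z * m)%C.
Proof.
intros [_ Hf] [_ Hg].
assert (Hf' : @is_derive C_AbsRing (AbsRing_NormedModule C_AbsRing) f z l)
  by (split; [exact (is_linear_scal_l (l : AbsRing_NormedModule C_AbsRing)) | exact Hf]).
assert (Hg' : @is_derive C_AbsRing (AbsRing_NormedModule C_AbsRing) g z m)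
  by (split; [exact (is_linear_scal_l (m : AbsRing_NormedModule C_AbsRing)) | exact Hg]).
destruct (@is_derive_mult C_AbsRing f g z l m Hf' Hg' Cmult_comm) as [_ H].
split; [apply is_linear_scal_l | exact H].
Qed.

Lemma proj_lift L (x : elliptic_curve L) : proj L (lift x) = x.
Proof.
unfold lift; destruct (constructive_indefinite_description _ _) as [z Hz]; simpl.
destruct x as [P HP]; simpl in *; subst P; unfold proj; f_equal.
apply proof_irrelevance.
Qed.

Lemma deriv_z_is_derive L (f : elliptic_curve L -> C) x :
  holomorphic_on (eq x) f ->
  @is_derive C_AbsRing C_NormedModule (fun w => f (proj L w)) (lift x) (deriv_z f x).
Proof.
intros Hf; apply (@C_derive_correct (fun w => f (proj L w)) (lift x) (RtoC 0)).
now apply Hf; rewrite proj_lift.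
Qed.

Lemma deriv_z_unique L (f : elliptic_curve L -> C) x l :
  @is_derive C_AbsRing C_NormedModule (fun w => f (proj L w)) (lift x) l ->
  deriv_z f x = l.
Proof. apply is_C_derive_unique. Qed.

Definition holomorphic_form_at (L : lattice) (w : form L) x : Prop :=
  holomorphic_on (eq x) (fun y => fst (fst w y)) /\
  holomorphic_on (eq x) (fun y => snd (fst w y)) /\
  holomorphic_on (eq x) (fun y => fst (snd w y)) /\
  holomorphic_on (eq x) (fun y => snd (snd w y)).

(* d is an odd superderivation *)
Lemma d_form_mult L (v w : form L) x :
  holomorphic_form_at v x -> holomorphic_form_at w x ->
  let dvw := plus (form_mult (d_form v) w) (form_mult (form_parity v) (d_form w)) in
  fst (d_form (form_mult v w)) x = fst dvw x /\
  snd (d_form (form_mult v w)) x = snd dvw x.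
Proof.
intros (V1 & V2 & _ & _) (W1 & W2 & _ & _) dvw.
apply deriv_z_is_derive in V1; apply deriv_z_is_derive in V2.
apply deriv_z_is_derive in W1; apply deriv_z_is_derive in W2.
pose proof (is_C_derive_mult V1 W1) as E1.
pose proof (is_C_derive_plus (is_C_derive_mult V1 W2) (is_C_derive_mult V2 W1)) as E2.
apply deriv_z_unique with (f := fun y => (fst (fst v y) * fst (fst w y))%C) in E1.
apply deriv_z_unique with
  (f := fun y => (fst (fst v y) * snd (fst w y) + snd (fst v y) * fst (fst w y))%C) in E2.
rewrite !proj_lift in E1, E2.
pose (a0 := fst (fst v x) : C); pose (a1 := snd (fst v x) : C).
pose (b0 := fst (snd v x) : C); pose (b1 := snd (snd v x) : C).
pose (c0 := fst (fst w x) : C); pose (c1 := snd (fst w x) : C).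
pose (e0 := fst (snd w x) : C); pose (e1 := snd (snd w x) : C).
pose (Da0 := deriv_z (fun y => fst (fst v y)) x).
pose (Da1 := deriv_z (fun y => snd (fst v y)) x).
pose (Dc0 := deriv_z (fun y => fst (fst w y)) x).
pose (Dc1 := deriv_z (fun y => snd (fst w y)) x).
split; apply injective_projections.
- cbn; ring.
- cbn; ring.
- etransitivity; [exact (f_equal2 Cplus E1 eq_refl) |].
  change (Da0 * c0 + a0 * Dc0 + - (a0 * e1 + - a1 * e0 + (b0 * c1 + b1 * c0))
    = a1 * e0 + (Da0 + - b1) * c0 + (a0 * (Dc0 + - e1) + - b0 * c1))%C.
  ring.
- etransitivity; [exact (f_equal2 Cplus E2 eq_refl) |].
  change (Da0 * c1 + a0 * Dc1 + (Da1 * c0 + a1 * Dc0) + - RtoC 0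
    = a1 * e1 + - RtoC 0 * e0 + ((Da0 + - b1) * c1 + (Da1 + - RtoC 0) * c0)
      + (a0 * (Dc1 + - RtoC 0) + - - a1 * (Dc0 + - e1) + (- b0 * RtoC 0 + - - b1 * c1)))%C.
  ring.
Qed.

(* Sections over an open set are represented by their extension by 0. *)
Definition restrict (L : lattice) (U : elliptic_curve L -> Prop) (f : sfun L) : sfun L :=
  fun x => if excluded_middle_informative (U x) then f x else zero.

Definition restrict_form (L : lattice) (U : elliptic_curve L -> Prop) (w : form L) : form L :=
  (restrict U (fst w), restrict U (snd w)).

Definition O_SE (L : lattice) (U : elliptic_curve L -> Prop) (f : sfun L) : Prop :=
  holomorphic_on U (fun x => fst (f x)) /\ holomorphic_on U (fun x => snd (f x))
  /\ forall x, ~ U x -> f x = zero.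

Definition Omega (L : lattice) (p : nat) (U : elliptic_curve L -> Prop) (w : form L) : Prop :=
  O_SE U (fst w) /\ O_SE U (snd w) /\ (p = 0%nat -> snd w = zero).

(** * The Cech-de Rham double complex

    A q-cochain is a function of the sequences i_0, ..., i_q of indices
    (not necessarily distinct); it is set to 0 on sequences of other lengths. *)
Section CechDeRham.
Variables (L : lattice) (I : Type) (U : I -> elliptic_curve L -> Prop).

Definition inter (s : list I) (x : elliptic_curve L) : Prop := List.Forall (fun i => U i x) s.

Definition face (j : nat) (s : list I) : list I := firstn j s ++ skipn (S j) s.

Definition cochain : AbelianGroup := fct_AbelianGroup (list I) (form L).

Definition cech_term (p q : nat) (c : cochain) : Prop :=
  forall s, (length s = S q -> Omega p (inter s) (c s))
         /\ (length s <> S q -> c s = zero).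

Definition cech_diff (c : cochain) : cochain := fun s =>
  restrict_form (inter s) (sum_n (fun j => alt j (c (face j s))) (pred (length s))).

Definition de_rham_diff (c : cochain) : cochain := fun s =>
  restrict_form (inter s) (d_form (c s)).

(* Open subsets different from E are Stein, hence so are the finite
   intersections, and the Cech cohomology of such a cover with values in Omega^p
   is that of SE. *)
Definition proper_open_cover : Prop :=
  (forall i, open_E (U i)) /\ (forall i, exists x, ~ U i x) /\ (forall x, exists i, U i x).

Definition d1_nonzero (p q : nat) : Prop :=
  page_diff_nonzero cech_term de_rham_diff cech_diff 1 p q.

Definition hodge_de_rham_converges_at_page (r : nat) : Prop :=
  converges_at_page cech_term de_rham_diff cech_diff r.

End CechDeRham.

(** * Kaehler metrics on E *)

Fixpoint continuously_differentiable (n : nat) (g : R -> R -> R) : Prop :=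
  match n with
  | O => forall x y, continuity_2d_pt g x y
  | S m =>
      (forall x y, ex_derive (fun t => g t y) x /\ ex_derive (fun t => g x t) y)
      /\ continuously_differentiable m (fun x y => Derive (fun t => g t y) x)
      /\ continuously_differentiable m (fun x y => Derive (fun t => g x t) y)
  end.

(* The Hermitian metric h |dz|^2, for h smooth and positive.  Its fundamental
   form (i/2) h dz dzbar is closed since E has real dimension 2, so that every
   Hermitian metric on E is Kaehler. *)
Definition kaehler_metric (L : lattice) (h : elliptic_curve L -> R) : Prop :=
  (forall x, (0 < h x)%R)
  /\ forall n, continuously_differentiable n (fun x y => h (proj L (x, y))).

(* Main.v *)
(* A p-form d(theta)^p (a0 + theta a1) + dz d(theta)^(p-1) (b0 + theta b1) has differential
   given by (a0, a1, b0, b1) |-> (a1, 0, a0' - b1, a1').  The O-linear map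
   (a0, a1, b0, b1) |-> (0, a0, 0, - b0) is a contracting homotopy of this complex in
   degrees p >= 2, and it commutes with the Cech differential.  Hence E_2^{p,q} = 0 for
   p >= 2, so that d_r = 0 for r >= 2 and E_2 = E_oo, without any knowledge of the
   Cech cohomology of the cover.

   On page one, d_1 maps the class of d(theta)^p theta to that of d(theta)^(p+1), which is
   non-zero in row 0.  In row 1 it maps dz d(theta)^(p-1) theta c to - dz d(theta)^p c for a
   Cech 1-cocycle c of O_E, so one needs c not to be a coboundary.  Such a c is obtained from
   differences of translates of a zeta function with quasi-periods 0 and 1; if it were a
   coboundary, there would be an entire function f with f (z + u) = f z and
   f (z + v) = f z + 1, whose integral along the boundary of the period parallelogram is - u,
   against Goursat's theorem. *)
Require Import Defs.
From Stdlib Require Import Reals List ZArith Lra Lia.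
From Stdlib Require Import ClassicalEpsilon FunctionalExtensionality PropExtensionality ProofIrrelevance.
From Coquelicot Require Import Coquelicot.

Set Implicit Arguments.
Unset Strict Implicit.
Unset Printing Implicit Defensive.

Local Open Scope R_scope.

(** The homotopy starts only at [p = 2] because it sends a [dz] component to a [dz] component, and
    degree 0 has none. Columns 0 and 1 are left over, but a differential [d_r] with [r >= 2] always
    ends in column [p + r >= 2]. As pages are subquotients cut out by [Zcyc] and [Bbd], degeneration
    is proved as equality of subgroups: a zigzag in the total complex is cut short by a correction
    with the homotopy. That [dh] maps [K p q] into [K (S p) q] would mean that derivatives of
    holomorphic functions are holomorphic. Membership of a [dh] image is instead read off from the
    condition that [Dtot X] lies in [Tot], and the explicit classes are chosen so that their
    differentials contain no derivative of an unknown function. Holomorphic means complex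
    differentiable, with nothing said about the derivative, hence the subdivision argument for the
    contour integral. The Lambert series makes zeta a geometrically convergent sum whose
    quasi-period is a shift of the index. Its poles are placed at points omitted by the members of
    the cover, which is where their being proper subsets enters. *)

Definition Cderiv_at (f : C -> C) (z l : C) : Prop :=
  forall eps : R, 0 < eps -> exists delta : R, 0 < delta /\
    forall w : C, Cmod (w - z) < delta ->
      Cmod (f w - f z - (w - z) * l) <= eps * Cmod (w - z).

(** The balls of [C_UniformSpace] are squares, those of [Cmod] are discs; [sqrt 2] compares the
    two. *)
Lemma locally_Cmod (P : C -> Prop) (z : C) :
  @locally C_UniformSpace z P <->
  exists delta : R, 0 < delta /\ forall w : C, Cmod (w - z) < delta -> P w.
Proof.
split.
- intros [d Hd]; exists d; split; [apply cond_pos |].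
  intros w Hw; apply Hd; apply C_NormedModule_mixin_compat1; exact Hw.
- intros (d & Hd & H).
  assert (Hs : 0 < sqrt 2) by (apply sqrt_lt_R0; lra).
  exists (mkposreal _ (Rdiv_lt_0_compat _ _ Hd Hs)).
  intros w Hw; apply H.
  apply C_NormedModule_mixin_compat2 in Hw; simpl in Hw.
  replace (sqrt 2 * (d / sqrt 2)) with d in Hw by (field; lra).
  exact Hw.
Qed.

Lemma is_C_derive_iff (f : C -> C) (z l : C) :
  @is_derive C_AbsRing C_NormedModule f z l <-> Cderiv_at f z l.
Proof.
split.
- intros [_ H] eps Heps.
  specialize (H z (fun P HP => HP) (mkposreal _ Heps)).
  destruct H as [d Hd]; exists d; split; [apply cond_pos |].
  intros w Hw; exact (Hd w Hw).
- intros H; split; [apply is_linear_scal_l |].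
  intros x Hx eps.
  assert (E : z = x) by (apply (@is_filter_lim_locally_unique C_AbsRing (AbsRing_NormedModule C_AbsRing)); exact Hx).
  subst x.
  destruct (H eps (cond_pos eps)) as (d & Hd & H').
  exists (mkposreal _ Hd); intros w Hw; exact (H' w Hw).
Qed.

Lemma ex_C_derive_iff (f : C -> C) (z : C) :
  @ex_derive C_AbsRing C_NormedModule f z <-> exists l, Cderiv_at f z l.
Proof. split; intros [l H]; exists l; apply is_C_derive_iff; exact H. Qed.

Lemma Cmod_triangle_sub (a b : C) : Cmod (a - b) <= Cmod a + Cmod b.
Proof. rewrite <- (Cmod_opp b); apply Cmod_triangle. Qed.

Lemma Cmod_le_Re_Im (c : C) : Cmod c <= Rabs (Re c) + Rabs (Im c).
Proof.
replace c with (RtoC (Re c) + Ci * RtoC (Im c))%C at 1.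
- eapply Rle_trans; [apply Cmod_triangle |].
  rewrite Cmod_mult, Cmod_Ci, !Cmod_R; lra.
- destruct c as [x y]; unfold Ci, RtoC, Cplus, Cmult, Re, Im; simpl; f_equal; ring.
Qed.

Lemma im_le_Cmod (c : C) : Rabs (Im c) <= Cmod c.
Proof. eapply Rle_trans; [apply Rmax_r | apply Rmax_Cmod]. Qed.

Lemma Cderiv_at_Lipschitz (f : C -> C) (z l : C) :
  Cderiv_at f z l -> exists delta : R, 0 < delta /\
    forall w, Cmod (w - z) < delta -> Cmod (f w - f z) <= (Cmod l + 1) * Cmod (w - z).
Proof.
intros H; destruct (H 1 Rlt_0_1) as (d & Hd & Hw); exists d; split; [exact Hd |].
intros w Hwz; specialize (Hw w Hwz).
replace (f w - f z)%C with ((f w - f z - (w - z) * l) + (w - z) * l)%C by ring.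
eapply Rle_trans; [apply Cmod_triangle |].
rewrite (Cmod_mult (w - z)); lra.
Qed.

Lemma Cderiv_at_comp (f g : C -> C) (z l m : C) :
  Cderiv_at g z m -> Cderiv_at f (g z) l -> Cderiv_at (fun w => f (g w)) z (m * l).
Proof.
intros Hg Hf eps Heps.
destruct (Cderiv_at_Lipschitz Hg) as (d1 & Hd1 & H1).
pose proof (Cmod_ge_0 m) as Pm; pose proof (Cmod_ge_0 l) as Pl.
(* Each of the two remainders gets half of [eps]; the [+ 1] keeps the denominators positive when a
   derivative vanishes. *)
assert (He1 : 0 < eps / (2 * (Cmod m + 1))) by (apply Rdiv_lt_0_compat; lra).
assert (He2 : 0 < eps / (2 * (Cmod l + 1))) by (apply Rdiv_lt_0_compat; lra).
destruct (Hf _ He1) as (d2 & Hd2 & H2).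
destruct (Hg _ He2) as (d3 & Hd3 & H3).
assert (Hd4 : 0 < d2 / (Cmod m + 1)) by (apply Rdiv_lt_0_compat; lra).
exists (Rmin d1 (Rmin d3 (d2 / (Cmod m + 1)))); split.
{ repeat apply Rmin_glb_lt; assumption. }
intros w Hw.
assert (W1 : Cmod (w - z) < d1) by (eapply Rlt_le_trans; [exact Hw | apply Rmin_l]).
assert (W2 : Cmod (w - z) < Rmin d3 (d2 / (Cmod m + 1)))
  by (eapply Rlt_le_trans; [exact Hw | apply Rmin_r]).
assert (W3 : Cmod (w - z) < d3) by (eapply Rlt_le_trans; [exact W2 | apply Rmin_l]).
assert (W4 : Cmod (w - z) < d2 / (Cmod m + 1)) by (eapply Rlt_le_trans; [exact W2 | apply Rmin_r]).
specialize (H1 w W1); specialize (H3 w W3).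
assert (W5 : Cmod (g w - g z) < d2).
{ eapply Rle_lt_trans; [exact H1 |].
  apply (Rmult_lt_compat_l (Cmod m + 1)) in W4; [| lra].
  replace ((Cmod m + 1) * (d2 / (Cmod m + 1))) with d2 in W4 by (field; lra); exact W4. }
specialize (H2 (g w) W5).
replace (f (g w) - f (g z) - (w - z) * (m * l))%C
  with ((f (g w) - f (g z) - (g w - g z) * l) + (g w - g z - (w - z) * m) * l)%C by ring.
eapply Rle_trans; [apply Cmod_triangle |].
rewrite (Cmod_mult (g w - g z - (w - z) * m)).
assert (B1 : eps / (2 * (Cmod m + 1)) * Cmod (g w - g z) <= eps / 2 * Cmod (w - z)).
{ replace (eps / 2 * Cmod (w - z))
    with (eps / (2 * (Cmod m + 1)) * ((Cmod m + 1) * Cmod (w - z))) by (field; lra).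
  apply Rmult_le_compat_l; [lra | exact H1]. }
assert (B2 : Cmod (g w - g z - (w - z) * m) * Cmod l <= eps / 2 * Cmod (w - z)).
{ apply Rle_trans with (eps / (2 * (Cmod l + 1)) * Cmod (w - z) * (Cmod l + 1)).
  - apply Rmult_le_compat; try lra; try apply Cmod_ge_0.
  - right; field; lra. }
lra.
Qed.

Lemma Cderiv_at_ext_loc (f g : C -> C) (z l : C) :
  (exists delta : R, 0 < delta /\ forall w, Cmod (w - z) < delta -> f w = g w) ->
  Cderiv_at f z l -> Cderiv_at g z l.
Proof.
intros (d & Hd & E) H eps Heps.
destruct (H eps Heps) as (d' & Hd' & H').
exists (Rmin d d'); split; [apply Rmin_glb_lt; assumption |].
intros w Hw.
rewrite <- (E w), <- (E z).
- apply H'; eapply Rlt_le_trans; [exact Hw | apply Rmin_r].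
- replace (z - z)%C with (RtoC 0) by ring; rewrite Cmod_0; exact Hd.
- eapply Rlt_le_trans; [exact Hw | apply Rmin_l].
Qed.

Lemma Cderiv_at_affine (a b z : C) : Cderiv_at (fun w => a * w + b)%C z a.
Proof.
intros eps Heps; exists 1; split; [lra |]; intros w _.
replace (a * w + b - (a * z + b) - (w - z) * a)%C with (RtoC 0) by ring.
rewrite Cmod_0; apply Rmult_le_pos; [lra | apply Cmod_ge_0].
Qed.

Lemma Cderiv_at_minus (f g : C -> C) (z l m : C) :
  Cderiv_at f z l -> Cderiv_at g z m -> Cderiv_at (fun w => f w - g w)%C z (l - m)%C.
Proof.
intros Hf Hg; apply is_C_derive_iff.
exact (@is_derive_minus C_AbsRing C_NormedModule _ _ _ _ _
  (proj2 (is_C_derive_iff _ _ _) Hf) (proj2 (is_C_derive_iff _ _ _) Hg)).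
Qed.

(** * Goursat's theorem for parallelograms *)

(* The contour integral of f along [z, z + u] is u times this. *)
Definition segment_mean (f : C -> C) (z u : C) : C :=
  (RInt (fun t => Re (f (z + RtoC t * u)%C)) 0 1, RInt (fun t => Im (f (z + RtoC t * u)%C)) 0 1).

(** The contour runs through [z], [z + u], [z + u + v], [z + v]. Opposite sides are paired, so that
    quasi-periodicity can be applied to each difference. *)
Definition parallelogram_integral (f : C -> C) (z u v : C) : C :=
  (u * (segment_mean f z u - segment_mean f (z + v) u)
   + v * (segment_mean f (z + u) v - segment_mean f z v))%C.

Definition C_differentiable (f : C -> C) : Prop := forall z, exists l, Cderiv_at f z l.

(** [P] stands for [Re] or [Im]; the 1-Lipschitz bound lets one proof serve both. *)
Lemma real_part_on_segment_continuous (P : C -> R) (f : C -> C) (z u : C) :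
  (forall a b : C, Rabs (P a - P b) <= Cmod (a - b)) -> C_differentiable f ->
  forall t : R, continuous (fun t => P (f (z + RtoC t * u)%C)) t.
Proof.
intros HP Hf t P' [eps He].
destruct (Hf (z + RtoC t * u)%C) as [l Hl].
destruct (Cderiv_at_Lipschitz Hl) as (d & Hd & H).
pose proof (Cmod_ge_0 l) as Pl; pose proof (Cmod_ge_0 u) as Pu; pose proof (cond_pos eps) as Pe.
assert (K : 0 < (Cmod l + 1) * (Cmod u + 1)) by (apply Rmult_lt_0_compat; lra).
assert (D : 0 < Rmin (d / (Cmod u + 1)) (eps / ((Cmod l + 1) * (Cmod u + 1))))
  by (apply Rmin_glb_lt; apply Rdiv_lt_0_compat; lra).
exists (mkposreal _ D); intros s Hs; apply He.
change (Rabs (s - t) < Rmin (d / (Cmod u + 1)) (eps / ((Cmod l + 1) * (Cmod u + 1)))) in Hs.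
change (Rabs (P (f (z + RtoC s * u)%C) - P (f (z + RtoC t * u)%C)) < eps).
assert (Hs1 := Rlt_le_trans _ _ _ Hs (Rmin_l _ _)).
assert (Hs2 := Rlt_le_trans _ _ _ Hs (Rmin_r _ _)).
assert (E : Cmod (z + RtoC s * u - (z + RtoC t * u)) = Rabs (s - t) * Cmod u).
{ replace (z + RtoC s * u - (z + RtoC t * u))%C with (RtoC (s - t) * u)%C
    by (rewrite RtoC_minus; ring).
  rewrite Cmod_mult, Cmod_R; reflexivity. }
pose proof (Rabs_pos (s - t)) as Ps.
apply (Rmult_lt_compat_r (Cmod u + 1)) in Hs1; [| lra].
replace (d / (Cmod u + 1) * (Cmod u + 1)) with d in Hs1 by (field; lra).
apply (Rmult_lt_compat_r ((Cmod l + 1) * (Cmod u + 1))) in Hs2; [| lra].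
replace (eps / ((Cmod l + 1) * (Cmod u + 1)) * ((Cmod l + 1) * (Cmod u + 1)))
  with (pos eps) in Hs2 by (field; lra).
eapply Rle_lt_trans; [apply HP |].
eapply Rle_lt_trans; [apply H; rewrite E; nra |].
rewrite E; nra.
Qed.

Lemma Re_Lipschitz (a b : C) : Rabs (Re a - Re b) <= Cmod (a - b).
Proof. replace (Re a - Re b) with (Re (a - b)) by reflexivity; apply re_le_Cmod. Qed.

Lemma Im_Lipschitz (a b : C) : Rabs (Im a - Im b) <= Cmod (a - b).
Proof. replace (Im a - Im b) with (Im (a - b)) by reflexivity; apply im_le_Cmod. Qed.

Lemma ex_RInt_on_segment (P : C -> R) (f : C -> C) (z u : C) (a b : R) :
  (forall a b : C, Rabs (P a - P b) <= Cmod (a - b)) -> C_differentiable f ->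
  ex_RInt (fun t => P (f (z + RtoC t * u)%C)) a b.
Proof.
intros HP Hf; apply (@ex_RInt_continuous R_CompleteNormedModule); intros t _.
apply real_part_on_segment_continuous; assumption.
Qed.

Lemma RInt_halves (g : R -> R) :
  (forall a b, ex_RInt g a b) ->
  RInt g 0 1 = (RInt (fun t => g (t / 2)) 0 1 + RInt (fun t => g (1 / 2 + t / 2)) 0 1) / 2.
Proof.
intros Hg.
rewrite <- (@RInt_Chasles R_CompleteNormedModule g 0 (1 / 2) 1) by apply Hg.
pose proof (@RInt_comp_lin R_CompleteNormedModule g (1 / 2) 0 0 1 (Hg _ _)) as E1.
pose proof (@RInt_comp_lin R_CompleteNormedModule g (1 / 2) (1 / 2) 0 1 (Hg _ _)) as E2.
replace (1 / 2 * 0 + 0) with 0 in E1 by field.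
replace (1 / 2 * 1 + 0) with (1 / 2) in E1 by field.
replace (1 / 2 * 0 + 1 / 2) with (1 / 2) in E2 by field.
replace (1 / 2 * 1 + 1 / 2) with 1 in E2 by field.
assert (X1 : ex_RInt (fun t => g (t / 2)) 0 1).
{ apply (@ex_RInt_ext R_CompleteNormedModule (fun t => scal 2 (scal (1/2) (g (1 / 2 * t + 0))))).
  - intros x _; unfold scal; simpl; unfold mult; simpl.
    replace (1 / 2 * x + 0) with (x / 2) by field; field.
  - apply (@ex_RInt_scal R_CompleteNormedModule), (@ex_RInt_comp_lin R_CompleteNormedModule), Hg. }
assert (X2 : ex_RInt (fun t => g (1 / 2 + t / 2)) 0 1).
{ apply (@ex_RInt_ext R_CompleteNormedModule (fun t => scal 2 (scal (1/2) (g (1 / 2 * t + 1 / 2))))).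
  - intros x _; unfold scal; simpl; unfold mult; simpl.
    replace (1 / 2 * x + 1 / 2) with (1 / 2 + x / 2) by field; field.
  - apply (@ex_RInt_scal R_CompleteNormedModule), (@ex_RInt_comp_lin R_CompleteNormedModule), Hg. }
rewrite <- E1, <- E2.
rewrite (@RInt_ext R_CompleteNormedModule (fun y => scal (1 / 2) (g (1 / 2 * y + 0)))
  (fun y => scal (1 / 2) (g (y / 2))))
  by (intros x _; do 2 f_equal; field).
rewrite (@RInt_ext R_CompleteNormedModule (fun y => scal (1 / 2) (g (1 / 2 * y + 1 / 2)))
  (fun y => scal (1 / 2) (g (1 / 2 + y / 2))))
  by (intros x _; do 2 f_equal; field).
rewrite !(@RInt_scal R_CompleteNormedModule) by assumption.
unfold plus, scal; simpl; unfold mult; simpl; field.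
Qed.

Lemma segment_mean_halves (f : C -> C) (z u : C) :
  C_differentiable f ->
  segment_mean f z u =
    ((segment_mean f z (u / 2) + segment_mean f (z + u / 2) (u / 2)) / 2)%C.
Proof.
intros Hf; unfold segment_mean.
assert (H : forall P : C -> R, (forall a b : C, Rabs (P a - P b) <= Cmod (a - b)) ->
  RInt (fun t => P (f (z + RtoC t * u)%C)) 0 1
  = (RInt (fun t => P (f (z + RtoC t * (u / 2))%C)) 0 1
     + RInt (fun t => P (f (z + u / 2 + RtoC t * (u / 2))%C)) 0 1) / 2).
{ intros P HP.
  rewrite RInt_halves by (intros; apply ex_RInt_on_segment; assumption).
  f_equal; f_equal; apply (@RInt_ext R_CompleteNormedModule); intros x _; do 2 f_equal.
  - unfold Rdiv; rewrite RtoC_mult, RtoC_inv by lra; field.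
  - unfold Rdiv; rewrite RtoC_plus, !RtoC_mult, RtoC_inv by lra; field.
    }
rewrite (H Re Re_Lipschitz), (H Im Im_Lipschitz).
apply injective_projections; simpl; field.
Qed.

Lemma C2_neq_0 : RtoC 2 <> 0%C.
Proof. intro K; apply RtoC_inj in K; lra. Qed.

(** Each interior half side belongs to two of the quarters, which traverse it in opposite
    directions. *)
Lemma parallelogram_integral_split (f : C -> C) (z u v : C) :
  C_differentiable f ->
  parallelogram_integral f z u v =
    (parallelogram_integral f z (u / 2) (v / 2)
     + parallelogram_integral f (z + u / 2) (u / 2) (v / 2)
     + parallelogram_integral f (z + v / 2) (u / 2) (v / 2)
     + parallelogram_integral f (z + u / 2 + v / 2) (u / 2) (v / 2))%C.
Proof.
intros Hf; unfold parallelogram_integral.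
rewrite (segment_mean_halves z u Hf), (segment_mean_halves (z + v) u Hf).
rewrite (segment_mean_halves (z + u) v Hf), (segment_mean_halves z v Hf).
replace (z + u / 2 + u / 2)%C with (z + u)%C by (field; exact C2_neq_0).
replace (z + v / 2 + v / 2)%C with (z + v)%C by (field; exact C2_neq_0).
replace (z + u / 2 + v / 2 + u / 2)%C with (z + u + v / 2)%C by (field; exact C2_neq_0).
replace (z + u / 2 + v / 2 + v / 2)%C with (z + v + u / 2)%C by (field; exact C2_neq_0).
replace (z + v / 2 + u / 2)%C with (z + u / 2 + v / 2)%C by ring.
field; exact C2_neq_0.
Qed.

Lemma RInt_affine (a b : R) : RInt (fun t => a + b * t) 0 1 = a + b / 2.
Proof.
apply (@is_RInt_unique R_CompleteNormedModule).
replace (a + b / 2) with (minus (a * 1 + b * 1 ^ 2 / 2) (a * 0 + b * 0 ^ 2 / 2))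
  by (unfold minus, plus, opp; simpl; field).
apply (@is_RInt_derive R_CompleteNormedModule (fun t => a * t + b * t ^ 2 / 2)).
- intros x _; auto_derive; [exact I | field].
- intros x _; apply (@continuous_plus _ _ R_NormedModule);
    [apply continuous_const |].
  apply (@continuous_scal_r _ R_AbsRing R_NormedModule), continuous_id.
Qed.

(** The mean of an affine function over a segment is its value at the midpoint. The factor 2 comes
    from bounding real and imaginary parts separately. *)
Lemma segment_mean_near_affine (f : C -> C) (z u b l : C) (M : R) :
  C_differentiable f ->
  (forall t, 0 <= t <= 1 -> Cmod (f (z + RtoC t * u) - (b + l * (z + RtoC t * u)))%C <= M) ->
  Cmod (segment_mean f z u - (b + l * (z + u / 2))) <= 2 * M.
Proof.
intros Hf HM.
assert (H : forall (P : C -> R),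
  (forall a b : C, Rabs (P a - P b) <= Cmod (a - b)) ->
  (forall (a b : C) (t : R), P (a + RtoC t * b)%C = P a + P b * t) ->
  Rabs (RInt (fun t => P (f (z + RtoC t * u)%C)) 0 1 - P (b + l * (z + u / 2))%C) <= M).
{ intros P HP HA.
  assert (EP : forall t, P (b + l * (z + RtoC t * u))%C = P (b + l * z)%C + P (l * u)%C * t).
  { intro t; rewrite <- HA; f_equal; ring. }
  replace (P (b + l * (z + u / 2))%C) with
    (RInt (fun t => P (b + l * z)%C + P (l * u)%C * t) 0 1).
  2:{ rewrite RInt_affine.
      replace (b + l * (z + u / 2))%C with ((b + l * z) + RtoC (/ 2) * (l * u))%C.
      - rewrite HA; reflexivity.
      - rewrite RtoC_inv by lra; field. }
  assert (X1 := ex_RInt_on_segment z u 0 1 HP Hf).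
  assert (X2 : ex_RInt (fun t => P (b + l * z)%C + P (l * u)%C * t) 0 1).
  { apply (@ex_RInt_continuous R_CompleteNormedModule); intros x _.
    apply (@continuous_plus _ _ R_NormedModule); [apply continuous_const |].
    apply (@continuous_scal_r _ R_AbsRing R_NormedModule), continuous_id. }
  change (Rabs (minus (RInt (fun t => P (f (z + RtoC t * u)%C)) 0 1)
    (RInt (fun t => P (b + l * z)%C + P (l * u)%C * t) 0 1)) <= M).
  rewrite <- (@RInt_minus R_CompleteNormedModule) by assumption.
  replace M with ((1 - 0) * M) by ring.
  apply abs_RInt_le_const; [lra | apply (@ex_RInt_minus R_NormedModule); assumption |].
  intros t Ht; unfold minus, plus, opp; simpl; rewrite <- EP.
  eapply Rle_trans; [apply HP | apply HM; exact Ht]. }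
eapply Rle_trans; [apply Cmod_le_Re_Im |].
replace (2 * M) with (M + M) by ring; apply Rplus_le_compat.
- apply (H Re Re_Lipschitz); intros a b' t; destruct a, b'; simpl; unfold Re; simpl; ring.
- apply (H Im Im_Lipschitz); intros a b' t; destruct a, b'; simpl; unfold Im; simpl; ring.
Qed.

(** The local half of Goursat's argument: with the tangent affine function at a point, [M] is small
    compared with the diameter, so the integral is small compared with the square of the
    diameter. *)
Lemma parallelogram_integral_near_affine (f : C -> C) (z u v b l : C) (M : R) :
  C_differentiable f ->
  (forall s t, 0 <= s <= 1 -> 0 <= t <= 1 ->
     Cmod (f (z + RtoC s * u + RtoC t * v)
           - (b + l * (z + RtoC s * u + RtoC t * v)))%C <= M) ->
  Cmod (parallelogram_integral f z u v) <= 4 * M * (Cmod u + Cmod v).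
Proof.
intros Hf HM.
assert (J1 := @segment_mean_near_affine f z u b l M Hf).
assert (J2 := @segment_mean_near_affine f (z + v)%C u b l M Hf).
assert (J3 := @segment_mean_near_affine f (z + u)%C v b l M Hf).
assert (J4 := @segment_mean_near_affine f z v b l M Hf).
assert (K1 : Cmod (segment_mean f z u - (b + l * (z + u / 2))) <= 2 * M).
{ apply J1; intros t Ht; replace (z + RtoC t * u)%C with (z + RtoC t * u + RtoC 0 * v)%C by ring.
  apply HM; lra. }
assert (K2 : Cmod (segment_mean f (z + v) u - (b + l * (z + v + u / 2))) <= 2 * M).
{ apply J2; intros t Ht; replace (z + v + RtoC t * u)%C with (z + RtoC t * u + RtoC 1 * v)%C by ring.
  apply HM; lra. }
assert (K3 : Cmod (segment_mean f (z + u) v - (b + l * (z + u + v / 2))) <= 2 * M).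
{ apply J3; intros t Ht; replace (z + u + RtoC t * v)%C with (z + RtoC 1 * u + RtoC t * v)%C by ring.
  apply HM; lra. }
assert (K4 : Cmod (segment_mean f z v - (b + l * (z + v / 2))) <= 2 * M).
{ apply J4; intros t Ht; replace (z + RtoC t * v)%C with (z + RtoC 0 * u + RtoC t * v)%C by ring.
  apply HM; lra. }
(* the boundary integral of the affine function w |-> b + l w vanishes *)
replace (parallelogram_integral f z u v) with
 (u * ((segment_mean f z u - (b + l * (z + u / 2)))
       - (segment_mean f (z + v) u - (b + l * (z + v + u / 2))))
  + v * ((segment_mean f (z + u) v - (b + l * (z + u + v / 2)))
       - (segment_mean f z v - (b + l * (z + v / 2)))))%C
  by (unfold parallelogram_integral; field).
eapply Rle_trans; [apply Cmod_triangle |].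
rewrite !Cmod_mult.
replace (4 * M * (Cmod u + Cmod v)) with (Cmod u * (2 * M + 2 * M) + Cmod v * (2 * M + 2 * M)) by ring.
apply Rplus_le_compat; apply Rmult_le_compat_l; try apply Cmod_ge_0;
  (eapply Rle_trans; [apply Cmod_triangle_sub |]); lra.
Qed.

(** * Bisection of a square *)

Lemma half_pow_pos (n : nat) : 0 < (1 / 2) ^ n.
Proof. apply pow_lt; lra. Qed.

Lemma half_pow_small (d : R) : 0 < d -> exists n, (1 / 2) ^ n < d.
Proof.
intros Hd.
destruct (pow_lt_1_zero (1 / 2)) with (y := d) as [N HN]; [rewrite Rabs_pos_eq; lra | exact Hd |].
exists N; specialize (HN N (le_n N)); rewrite Rabs_pos_eq in HN; [exact HN |].
apply Rlt_le, half_pow_pos.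
Qed.

(** The [x n] are left ends of nested intervals of length [(1 / 2) ^ n]; their supremum lies in all
    of these. *)
Lemma nested_halves_limit (x : nat -> R) :
  (forall n, x n <= x (S n) <= x n + (1 / 2) ^ (S n)) ->
  exists a, forall n, x n <= a <= x n + (1 / 2) ^ n.
Proof.
intros Hx.
assert (H1 : forall n k, x n <= x (n + k)%nat).
{ intros n k; induction k as [| k IH]; [rewrite Nat.add_0_r; lra |].
  rewrite Nat.add_succ_r; destruct (Hx (n + k)%nat); lra. }
assert (H2 : forall n k, x (n + k)%nat + (1 / 2) ^ (n + k) <= x n + (1 / 2) ^ n).
{ intros n k; induction k as [| k IH]; [rewrite Nat.add_0_r; lra |].
  rewrite Nat.add_succ_r; destruct (Hx (n + k)%nat).
  eapply Rle_trans; [| exact IH]; simpl in *; lra. }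
assert (H3 : forall m n, x m <= x n + (1 / 2) ^ n).
{ intros m n; destruct (Nat.le_ge_cases m n) as [L | L].
  - replace n with (m + (n - m))%nat by lia.
    pose proof (H1 m (n - m)%nat); pose proof (half_pow_pos (m + (n - m))); lra.
  - replace m with (n + (m - n))%nat by lia.
    pose proof (H2 n (m - n)%nat); pose proof (half_pow_pos (n + (m - n))); lra. }
destruct (completeness (fun y => exists n, y = x n)) as [a [Ha1 Ha2]].
- exists (x 0%nat + (1 / 2) ^ 0); intros y [n ->]; apply H3.
- exists (x 0%nat); exists 0%nat; reflexivity.
- exists a; intros n; split.
  + apply Ha1; exists n; reflexivity.
  + apply Ha2; intros y [m ->]; apply H3.
Qed.

(** An induction principle, where [P x y n] speaks of the square with lower left corner [(x, y)] and
    side [(1 / 2) ^ n]. A failing square has a failing quarter, and the nested failing squares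
    shrink to a point [(a, b)], around which all small squares are good. *)
Lemma square_bisection (P : R -> R -> nat -> Prop) :
  (forall x y n, let h := (1 / 2) ^ (S n) in
     P x y (S n) -> P (x + h) y (S n) -> P x (y + h) (S n) -> P (x + h) (y + h) (S n) ->
     P x y n) ->
  (forall a b, exists delta, 0 < delta /\ forall x y n, (1 / 2) ^ n < delta ->
     x <= a <= x + (1 / 2) ^ n -> y <= b <= y + (1 / 2) ^ n -> P x y n) ->
  forall x y, P x y 0%nat.
Proof.
intros Hsub Hloc x0 y0.
apply NNPP; intro Hbad.
assert (Hstep : forall (n : nat) (c : R * R), exists c' : R * R,
  fst c <= fst c' <= fst c + (1 / 2) ^ (S n) /\ snd c <= snd c' <= snd c + (1 / 2) ^ (S n)
  /\ (~ P (fst c) (snd c) n -> ~ P (fst c') (snd c') (S n))).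
{ intros n [x y]; pose proof (half_pow_pos (S n)) as Hh; cbn [fst snd].
  destruct (classic (P x y (S n))) as [P1 | N1]; [| exists (x, y); cbn [fst snd]; (split; [split; lra | split; [split; lra | auto]])].
  destruct (classic (P (x + (1 / 2) ^ (S n)) y (S n))) as [P2 | N2];
    [| exists (x + (1 / 2) ^ (S n), y); cbn [fst snd]; (split; [split; lra | split; [split; lra | auto]])].
  destruct (classic (P x (y + (1 / 2) ^ (S n)) (S n))) as [P3 | N3];
    [| exists (x, y + (1 / 2) ^ (S n)); cbn [fst snd]; (split; [split; lra | split; [split; lra | auto]])].
  exists (x + (1 / 2) ^ (S n), y + (1 / 2) ^ (S n)); cbn [fst snd].
  split; [split; lra | split; [split; lra |]].
  intros N P4; apply N, Hsub; assumption. }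
set (step n c := proj1_sig (constructive_indefinite_description _ (Hstep n c))).
assert (Sstep : forall n c, fst c <= fst (step n c) <= fst c + (1 / 2) ^ (S n)
  /\ snd c <= snd (step n c) <= snd c + (1 / 2) ^ (S n)
  /\ (~ P (fst c) (snd c) n -> ~ P (fst (step n c)) (snd (step n c)) (S n))).
{ intros n c; unfold step; exact (proj2_sig (constructive_indefinite_description _ (Hstep n c))). }
set (s := fix s n := match n with O => (x0, y0) | S m => step m (s m) end).
assert (Hs : forall n, ~ P (fst (s n)) (snd (s n)) n).
{ induction n as [| n IH]; [exact Hbad | apply (Sstep n (s n)); exact IH]. }
destruct (@nested_halves_limit (fun n => fst (s n))) as [a Ha];
  [intro n; apply (Sstep n (s n)) |].
destruct (@nested_halves_limit (fun n => snd (s n))) as [b Hb];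
  [intro n; apply (Sstep n (s n)) |].
destruct (Hloc a b) as (d & Hd & H).
destruct (half_pow_small Hd) as [n Hn].
exact (Hs n (H _ _ _ Hn (Ha n) (Hb n))).
Qed.

Theorem Goursat_parallelogram (f : C -> C) (z u v : C) :
  C_differentiable f -> parallelogram_integral f z u v = 0%C.
Proof.
intros Hf; apply Cmod_eq_0, Rle_antisym; [| apply Cmod_ge_0].
apply le_epsilon; intros eps Heps; rewrite Rplus_0_l.
(* [x] and [y] are coordinates along [u] and [v]. The bound is proportional to the area, so four
   quarter bounds add up exactly to the bound for the whole. *)
set (P x y n := Cmod (parallelogram_integral f (z + RtoC x * u + RtoC y * v)
   (RtoC ((1 / 2) ^ n) * u) (RtoC ((1 / 2) ^ n) * v)) <= eps * ((1 / 2) ^ n * (1 / 2) ^ n)).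
assert (HP : P 0 0 0%nat).
2:{ unfold P in HP; simpl pow in HP.
    replace (z + RtoC 0 * u + RtoC 0 * v)%C with z in HP by ring.
    rewrite !Cmult_1_l in HP; lra. }
apply (square_bisection (P := P)).
- intros x y n h P1 P2 P3 P4; unfold P in *; fold h in P1, P2, P3, P4.
  rewrite parallelogram_integral_split by exact Hf.
  assert (Eh : (1 / 2) ^ n = 2 * h) by (unfold h; simpl; field).
  rewrite Eh, !RtoC_mult in *.
  replace (RtoC 2 * RtoC h * u / 2)%C with (RtoC h * u)%C by field.
  replace (RtoC 2 * RtoC h * v / 2)%C with (RtoC h * v)%C by field.
  replace (z + RtoC (x + h) * u + RtoC y * v)%C
    with (z + RtoC x * u + RtoC y * v + RtoC h * u)%C in P2 by (rewrite RtoC_plus; ring).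
  replace (z + RtoC x * u + RtoC (y + h) * v)%C
    with (z + RtoC x * u + RtoC y * v + RtoC h * v)%C in P3 by (rewrite RtoC_plus; ring).
  replace (z + RtoC (x + h) * u + RtoC (y + h) * v)%C
    with (z + RtoC x * u + RtoC y * v + RtoC h * u + RtoC h * v)%C in P4
    by (rewrite !RtoC_plus; ring).
  replace (eps * (2 * h * (2 * h))) with (eps * (h * h) + eps * (h * h) + eps * (h * h) + eps * (h * h))
    by ring.
  repeat (eapply Rle_trans; [apply Cmod_triangle |]; apply Rplus_le_compat; [| assumption]).
  assumption.
- intros a b; set (c := (z + RtoC a * u + RtoC b * v)%C).
  (* [h * N] bounds the distance from [c] inside a piece of scale [h], and the [+ 1] keeps [N]
     positive when [u] and [v] vanish. The denominator [4 * N * N] cancels the factor 4 of the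
     affine estimate, this diameter and the length of the sides. *)
  set (N := Cmod u + Cmod v + 1).
  pose proof (Cmod_ge_0 u) as Pu; pose proof (Cmod_ge_0 v) as Pv.
  assert (HN : 0 < N) by (unfold N; lra).
  assert (He : 0 < eps / (4 * N * N)) by (apply Rdiv_lt_0_compat; [lra | nra]).
  destruct (Hf c) as [l Hl]; destruct (Hl _ He) as (d & Hd & Hfc).
  exists (d / N); split; [apply Rdiv_lt_0_compat; assumption |].
  intros x y n Hn Hx Hy; unfold P; set (h := (1 / 2) ^ n) in *.
  assert (Hh : 0 < h) by apply half_pow_pos.
  assert (Hhd : h * N < d).
  { apply (Rmult_lt_compat_r N) in Hn; [| exact HN].
    replace (d / N * N) with d in Hn by (field; lra); exact Hn. }
  assert (HB : Cmod (parallelogram_integral f (z + RtoC x * u + RtoC y * v) (RtoC h * u) (RtoC h * v))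
    <= 4 * (eps / (4 * N * N) * (h * N)) * (Cmod (RtoC h * u) + Cmod (RtoC h * v))).
  { apply parallelogram_integral_near_affine with (b := (f c - l * c)%C) (l := l); [exact Hf |].
    intros s t Hs Ht.
    set (w := (z + RtoC x * u + RtoC y * v + RtoC s * (RtoC h * u) + RtoC t * (RtoC h * v))%C).
    assert (Hw : Cmod (w - c) <= h * N).
    { replace (w - c)%C with (RtoC (x + s * h - a) * u + RtoC (y + t * h - b) * v)%C
        by (unfold w, c; rewrite !RtoC_minus, !RtoC_plus, !RtoC_mult; ring).
      eapply Rle_trans; [apply Cmod_triangle |]; rewrite !Cmod_mult, !Cmod_R.
      assert (Rabs (x + s * h - a) <= h) by (apply Rabs_le; nra).
      assert (Rabs (y + t * h - b) <= h) by (apply Rabs_le; nra).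
      unfold N; nra. }
    replace (f w - (f c - l * c + l * w))%C with (f w - f c - (w - c) * l)%C by ring.
    eapply Rle_trans; [apply Hfc; lra |].
    apply Rmult_le_compat_l; [lra | exact Hw]. }
  eapply Rle_trans; [exact HB |].
  rewrite !Cmod_mult, Cmod_R, (Rabs_pos_eq h) by lra.
  replace (4 * (eps / (4 * N * N) * (h * N)) * (h * Cmod u + h * Cmod v))
    with (eps * (h * h) * ((Cmod u + Cmod v) / N)) by (field; lra).
  assert ((Cmod u + Cmod v) / N <= 1).
  { apply Rmult_le_reg_r with N; [exact HN |].
    replace ((Cmod u + Cmod v) / N * N) with (Cmod u + Cmod v) by (field; lra).
    unfold N; lra. }
  assert (0 < eps * (h * h)) by (apply Rmult_lt_0_compat; nra).
  nra.
Qed.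

(** The sides in direction [v] cancel and those in direction [u] leave [- u], so a vanishing
    integral contradicts [u <> 0]. *)
Theorem no_entire_additive_quasiperiod (f : C -> C) (u v : C) :
  C_differentiable f -> u <> 0%C ->
  (forall z, f (z + u)%C = f z) -> ~ (forall z, f (z + v)%C = (f z + 1)%C).
Proof.
intros Hf Hu Eu Ev; apply Hu.
pose proof (Goursat_parallelogram 0 u v Hf) as H; unfold parallelogram_integral in H.
assert (S1 : segment_mean f (0 + u)%C v = segment_mean f 0 v).
{ unfold segment_mean; f_equal; apply (@RInt_ext R_CompleteNormedModule); intros t _;
    replace (0 + u + RtoC t * v)%C with (0 + RtoC t * v + u)%C by ring; rewrite Eu; reflexivity. }
assert (S2 : segment_mean f (0 + v)%C u = (segment_mean f 0 u + 1)%C).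
{ change (segment_mean f 0 u + 1)%C with
    (RInt (fun t => Re (f (0 + RtoC t * u)%C)) 0 1 + 1,
     RInt (fun t => Im (f (0 + RtoC t * u)%C)) 0 1 + 0).
  unfold segment_mean; f_equal.
  - transitivity (RInt (fun t => plus (Re (f (0 + RtoC t * u)%C)) 1) 0 1).
    + apply (@RInt_ext R_CompleteNormedModule); intros t _.
      replace (0 + v + RtoC t * u)%C with (0 + RtoC t * u + v)%C by ring; rewrite Ev; reflexivity.
    + rewrite (@RInt_plus R_CompleteNormedModule).
      * rewrite (@RInt_const R_CompleteNormedModule); unfold plus, scal; simpl; unfold mult; simpl.
        f_equal; ring.
      * apply ex_RInt_on_segment; [exact Re_Lipschitz | exact Hf].
      * apply ex_RInt_const.
  - rewrite Rplus_0_r; apply (@RInt_ext R_CompleteNormedModule); intros t _.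
    replace (0 + v + RtoC t * u)%C with (0 + RtoC t * u + v)%C by ring; rewrite Ev.
    unfold Im; simpl; ring. }
rewrite S1, S2 in H.
rewrite <- (Copp_0), <- H; ring.
Qed.

(** * A function with additive quasi-periods *)

Definition Cexp (z : C) : C := (exp (Re z) * cos (Im z), exp (Re z) * sin (Im z)).

Lemma Cexp_plus (a b : C) : Cexp (a + b) = (Cexp a * Cexp b)%C.
Proof.
destruct a as [a1 a2], b as [b1 b2]; unfold Cexp, Cplus, Cmult, Re, Im; cbn [fst snd].
rewrite exp_plus, cos_plus, sin_plus; f_equal; ring.
Qed.

Lemma Cexp_0 : Cexp 0 = 1%C.
Proof.
unfold Cexp, RtoC, Re, Im; cbn [fst snd].
rewrite exp_0, cos_0, sin_0; f_equal; ring.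
Qed.

Lemma Cmod_Cexp (z : C) : Cmod (Cexp z) = exp (Re z).
Proof.
unfold Cmod, Cexp; cbn [fst snd].
replace ((exp (Re z) * cos (Im z)) ^ 2 + (exp (Re z) * sin (Im z)) ^ 2)
  with (Rsqr (exp (Re z)) * (Rsqr (sin (Im z)) + Rsqr (cos (Im z)))) by (unfold Rsqr; ring).
rewrite sin2_cos2, Rmult_1_r, sqrt_Rsqr; [reflexivity | apply Rlt_le, exp_pos].
Qed.

Lemma Cexp_neq_0 (z : C) : Cexp z <> 0%C.
Proof. apply Cmod_gt_0; rewrite Cmod_Cexp; apply exp_pos. Qed.

Lemma derivable_pt_lim_at_0 (f : R -> R) (l : R) :
  derivable_pt_lim f 0 l -> forall eps, 0 < eps -> exists delta, 0 < delta /\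
  forall h, Rabs h < delta -> Rabs (f h - f 0 - h * l) <= eps * Rabs h.
Proof.
intros H eps Heps; destruct (H eps Heps) as [d Hd]; exists d; split; [apply cond_pos |].
intros h Hh; destruct (Req_dec h 0) as [-> | Hn].
- rewrite Rabs_R0; replace (f 0 - f 0 - 0 * l) with 0 by ring; rewrite Rabs_R0; lra.
- specialize (Hd h Hn Hh); rewrite Rplus_0_l in Hd.
  replace (f h - f 0 - h * l) with (((f h - f 0) / h - l) * h) by (field; exact Hn).
  rewrite Rabs_mult; apply Rmult_le_compat_r; [apply Rabs_pos | lra].
Qed.

Lemma Cexp_derive_0 : Cderiv_at Cexp 0 1.
Proof.
intros eps0 Heps0.
(* Six units of [eps * Cmod w] are spent: two for each trigonometric remainder multiplied by
   [exp x <= 2], one for the remainder of [exp] and one for [(exp x - 1) * y]. The cap at 1 serves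
   to get [exp x <= 2]. *)
set (eps := Rmin (eps0 / 6) 1).
assert (Heps : 0 < eps) by (apply Rmin_glb_lt; lra).
assert (He0 : eps <= eps0 / 6) by apply Rmin_l.
assert (He1 : eps <= 1) by apply Rmin_r.
destruct (derivable_pt_lim_at_0 (derivable_pt_lim_exp 0) Heps) as (d1 & Hd1 & H1).
destruct (derivable_pt_lim_at_0 (derivable_pt_lim_cos 0) Heps) as (d2 & Hd2 & H2).
destruct (derivable_pt_lim_at_0 (derivable_pt_lim_sin 0) Heps) as (d3 & Hd3 & H3).
rewrite exp_0 in H1; rewrite sin_0, cos_0 in H2; rewrite sin_0, cos_0 in H3.
assert (Hd : 0 < Rmin (Rmin d1 (eps / 2)) (Rmin d2 d3)) by (repeat apply Rmin_glb_lt; lra).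
exists (Rmin (Rmin d1 (eps / 2)) (Rmin d2 d3)); split; [exact Hd |].
intros w Hw; replace (w - 0)%C with w in * by ring; rewrite Cexp_0.
assert (W1 : Cmod w < d1 /\ Cmod w < eps / 2 /\ Cmod w < d2 /\ Cmod w < d3).
{ pose proof (Rmin_l (Rmin d1 (eps / 2)) (Rmin d2 d3)).
  pose proof (Rmin_r (Rmin d1 (eps / 2)) (Rmin d2 d3)).
  pose proof (Rmin_l d1 (eps / 2)); pose proof (Rmin_r d1 (eps / 2)).
  pose proof (Rmin_l d2 d3); pose proof (Rmin_r d2 d3); lra. }
destruct W1 as (W1 & W2 & W3 & W4).
pose proof (re_le_Cmod w) as Rw; pose proof (im_le_Cmod w) as Iw.
set (x := Re w) in *; set (y := Im w) in *; set (m := Cmod w) in *.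
assert (K1 := H1 x ltac:(lra)); assert (K2 := H2 y ltac:(lra)); assert (K3 := H3 y ltac:(lra)).
assert (B1 : Rabs (exp x - 1) <= eps).
{ replace (exp x - 1) with ((exp x - 1 - x * 1) + x) by ring.
  eapply Rle_trans; [apply Rabs_triang |]; pose proof (Rabs_pos x); nra. }
assert (B2 : exp x <= 2) by (pose proof (Rle_abs (exp x - 1)); lra).
assert (B0 := exp_pos x).
eapply Rle_trans; [apply Cmod_le_Re_Im |].
replace (Re (Cexp w - 1 - w * 1)) with (exp x * (cos y - 1 - y * - 0) + (exp x - 1 - x * 1))
  by (unfold Cexp, x, y; destruct w; unfold Re, Im; simpl; ring).
replace (Im (Cexp w - 1 - w * 1)) with (exp x * (sin y - 0 - y * 1) + (exp x - 1) * y)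
  by (unfold Cexp, x, y; destruct w; unfold Re, Im; simpl; ring).
assert (C1 : Rabs (exp x * (cos y - 1 - y * - 0)) <= 2 * (eps * m)).
{ rewrite Rabs_mult, (Rabs_pos_eq (exp x)) by lra.
  apply Rmult_le_compat; [lra | apply Rabs_pos | exact B2 |].
  eapply Rle_trans; [exact K2 |]; apply Rmult_le_compat_l; lra. }
assert (C2 : Rabs (exp x - 1 - x * 1) <= eps * m).
{ eapply Rle_trans; [exact K1 |]; apply Rmult_le_compat_l; lra. }
assert (C3 : Rabs (exp x * (sin y - 0 - y * 1)) <= 2 * (eps * m)).
{ rewrite Rabs_mult, (Rabs_pos_eq (exp x)) by lra.
  apply Rmult_le_compat; [lra | apply Rabs_pos | exact B2 |].
  eapply Rle_trans; [exact K3 |]; apply Rmult_le_compat_l; lra. }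
assert (C4 : Rabs ((exp x - 1) * y) <= eps * m).
{ rewrite Rabs_mult; apply Rmult_le_compat; try apply Rabs_pos; assumption. }
pose proof (Rabs_triang (exp x * (cos y - 1 - y * - 0)) (exp x - 1 - x * 1)).
pose proof (Rabs_triang (exp x * (sin y - 0 - y * 1)) ((exp x - 1) * y)).
assert (0 <= m) by apply Cmod_ge_0.
assert (eps * m <= eps0 / 6 * m) by (apply Rmult_le_compat_r; assumption).
lra.
Qed.

(** The derivative at 0 is transported by [Cexp w = Cexp z * Cexp (w - z)]. *)
Lemma Cexp_derive (z : C) : Cderiv_at Cexp z (Cexp z).
Proof.
assert (H : Cderiv_at (fun w => Cexp (1 * w + - z)) z (1 * 1)%C).
{ apply (Cderiv_at_comp (f := Cexp) (g := fun w => (1 * w + - z)%C)); [apply Cderiv_at_affine |].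
  replace (1 * z + - z)%C with (RtoC 0) by ring; exact Cexp_derive_0. }
assert (K : Cderiv_at (fun w => Cexp z * w + 0)%C (Cexp (1 * z + - z)%C) (Cexp z))
  by apply Cderiv_at_affine.
pose proof (Cderiv_at_comp H K) as HK; cbv beta in HK.
replace (1 * 1 * Cexp z)%C with (Cexp z) in HK by ring.
eapply Cderiv_at_ext_loc; [| exact HK].
exists 1; split; [lra |]; intros w _.
rewrite Cplus_0_r, <- Cexp_plus; f_equal; ring.
Qed.

Definition two_pi_i : C := (0, 2 * PI).

Definition exp2pii (z : C) : C := Cexp (two_pi_i * z).

Lemma exp2pii_plus (a b : C) : exp2pii (a + b) = (exp2pii a * exp2pii b)%C.
Proof. unfold exp2pii; rewrite <- Cexp_plus; f_equal; ring. Qed.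

Lemma exp2pii_0 : exp2pii 0 = 1%C.
Proof. unfold exp2pii; rewrite Cmult_0_r; exact Cexp_0. Qed.

Lemma exp2pii_1 : exp2pii 1 = 1%C.
Proof.
unfold exp2pii; rewrite Cmult_1_r; unfold Cexp, two_pi_i, Re, Im; cbn [fst snd].
rewrite exp_0, cos_2PI, sin_2PI; unfold RtoC; f_equal; ring.
Qed.

Lemma exp2pii_neq_0 (z : C) : exp2pii z <> 0%C.
Proof. apply Cexp_neq_0. Qed.

Lemma exp2pii_opp (z : C) : exp2pii (- z) = (/ exp2pii z)%C.
Proof.
assert (H : (exp2pii (- z) * exp2pii z)%C = 1%C).
{ rewrite <- exp2pii_plus, <- exp2pii_0; f_equal; ring. }
pose proof (@exp2pii_neq_0 z) as Hz.
rewrite <- (Cmult_1_l (/ exp2pii z)), <- H; field; exact Hz.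
Qed.

Lemma exp2pii_nat_mult (n : nat) (z : C) : exp2pii (RtoC (INR n) * z) = (exp2pii z ^ n)%C.
Proof.
induction n as [| n IH].
- change (INR 0) with 0; rewrite Cmult_0_l; apply exp2pii_0.
- rewrite S_INR, RtoC_plus.
  replace ((RtoC (INR n) + 1) * z)%C with (z + RtoC (INR n) * z)%C by ring.
  rewrite exp2pii_plus, IH; reflexivity.
Qed.

(** The modulus forces [z] to be real; then [cos (2 * (PI * x)) = 1] means [sin (PI * x) = 0] by the
    double angle formula. *)
Lemma exp2pii_eq_1 (z : C) : exp2pii z = 1%C -> exists k : Z, z = RtoC (IZR k).
Proof.
intros H; pose proof PI_RGT_0 as HPI.
assert (HM : exp (Re (two_pi_i * z)) = 1).
{ rewrite <- Cmod_Cexp; unfold exp2pii in H; rewrite H; exact Cmod_1. }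
destruct z as [x y].
assert (Ey : y = 0).
{ rewrite <- exp_0 in HM; apply exp_inv in HM; unfold Re in HM; simpl in HM.
  assert (E : PI * y = 0) by lra.
  apply Rmult_integral in E; lra. }
subst y.
assert (HC : cos (2 * (PI * x)) = 1).
{ unfold exp2pii in H; apply (f_equal fst) in H; unfold Cexp in H; cbn [fst snd] in H.
  unfold RtoC in H; rewrite HM, Rmult_1_l in H; cbn [fst] in H.
  rewrite <- H; f_equal; unfold Im; simpl; ring. }
rewrite cos_2a_sin in HC.
assert (HS : sin (PI * x) = 0) by nra.
apply sin_eq_0_0 in HS; destruct HS as [k Hk]; exists k.
unfold RtoC; f_equal; apply (Rmult_eq_reg_l PI); [rewrite Hk; ring | lra].
Qed.

Lemma exp2pii_derive (z : C) : exists l, Cderiv_at exp2pii z l.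
Proof.
assert (H : Cderiv_at (fun w => two_pi_i * w)%C z two_pi_i).
{ eapply Cderiv_at_ext_loc; [| apply (Cderiv_at_affine two_pi_i 0)].
  exists 1; split; [lra |]; intros w _; apply Cplus_0_r. }
eexists; exact (Cderiv_at_comp H (Cexp_derive _)).
Qed.

(** * Complex series dominated by a geometric series *)

Definition Csum (a : nat -> C) : C := (Series (fun n => Re (a n)), Series (fun n => Im (a n))).

Section GeometricallyDominated.
Variables (r : R) (Hr : 0 <= r < 1).

Let dominated (a : nat -> C) (M : R) : Prop := forall n, Cmod (a n) <= M * r ^ n.

Lemma ex_series_dominated (a : nat -> R) (M : R) :
  (forall n, Rabs (a n) <= M * r ^ n) -> ex_series a.
Proof.
intros H; apply (@ex_series_le R_AbsRing R_CompleteNormedModule a (fun n => M * r ^ n)); [exact H |].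
apply (@ex_series_scal_l R_AbsRing); apply ex_series_geom; rewrite Rabs_pos_eq; lra.
Qed.

Lemma ex_series_Re (a : nat -> C) (M : R) : dominated a M -> ex_series (fun n => Re (a n)).
Proof.
intros H; apply ex_series_dominated with M; intros n.
eapply Rle_trans; [apply re_le_Cmod | apply H].
Qed.

Lemma ex_series_Im (a : nat -> C) (M : R) : dominated a M -> ex_series (fun n => Im (a n)).
Proof.
intros H; apply ex_series_dominated with M; intros n.
eapply Rle_trans; [apply im_le_Cmod | apply H].
Qed.

Lemma Csum_ext (a b : nat -> C) : (forall n, a n = b n) -> Csum a = Csum b.
Proof. intros H; unfold Csum; f_equal; apply Series_ext; intros n; rewrite H; reflexivity. Qed.

Lemma Csum_minus (a b : nat -> C) (M N : R) : dominated a M -> dominated b N ->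
  Csum (fun n => a n - b n)%C = (Csum a - Csum b)%C.
Proof.
intros Ha Hb.
transitivity (Series (fun n => Re (a n)) - Series (fun n => Re (b n)),
              Series (fun n => Im (a n)) - Series (fun n => Im (b n))); [| reflexivity].
rewrite <- !Series_minus by (eapply ex_series_Re + eapply ex_series_Im; eassumption).
reflexivity.
Qed.

Lemma Csum_scal (c : C) (a : nat -> C) (M : R) : dominated a M ->
  Csum (fun n => c * a n)%C = (c * Csum a)%C.
Proof.
intros Ha; pose proof (ex_series_Re Ha) as Hr'; pose proof (ex_series_Im Ha) as Hi.
assert (S1 : forall (k : R) (x : nat -> R), ex_series x -> ex_series (fun n => k * x n))
  by (intros k x Hx; apply (@ex_series_scal_l R_AbsRing), Hx).
transitivity (Re c * Series (fun n => Re (a n)) - Im c * Series (fun n => Im (a n)),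
              Re c * Series (fun n => Im (a n)) + Im c * Series (fun n => Re (a n)));
  [| reflexivity].
rewrite <- !Series_scal_l, <- Series_minus, <- Series_plus by auto.
reflexivity.
Qed.

Lemma Csum_incr_1 (a : nat -> C) (M : R) : dominated a M ->
  Csum a = (a 0%nat + Csum (fun n => a (S n)))%C.
Proof.
intros Ha; unfold Csum.
rewrite (Series_incr_1 _ (ex_series_Re Ha)), (Series_incr_1 _ (ex_series_Im Ha)).
reflexivity.
Qed.

Lemma Cmod_Csum_le (a : nat -> C) (M : R) : dominated a M -> Cmod (Csum a) <= 2 * M * / (1 - r).
Proof.
intros Ha.
assert (H : forall x : nat -> R, (forall n, Rabs (x n) <= M * r ^ n) ->
  Rabs (Series x) <= M * / (1 - r)).
{ intros x Hx.
  assert (E1 : ex_series (fun n => M * r ^ n)).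
  { apply (@ex_series_scal_l R_AbsRing), ex_series_geom; rewrite Rabs_pos_eq; lra. }
  eapply Rle_trans; [apply Series_Rabs |].
  - apply ex_series_dominated with M; intros n; rewrite Rabs_Rabsolu; apply Hx.
  - eapply Rle_trans; [apply Series_le; [| exact E1] |].
    + intros n; split; [apply Rabs_pos | apply Hx].
    + rewrite Series_scal_l, Series_geom; [lra | rewrite Rabs_pos_eq; lra]. }
eapply Rle_trans; [apply Cmod_le_Re_Im |].
replace (2 * M * / (1 - r)) with (M * / (1 - r) + M * / (1 - r)) by ring.
apply Rplus_le_compat; apply H; intros n;
  (eapply Rle_trans; [| apply Ha]); [apply re_le_Cmod | apply im_le_Cmod].
Qed.

End GeometricallyDominated.

Lemma C1_minus_neq_0 (a : C) : a <> 1%C -> (1 - a)%C <> 0%C.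
Proof. intros H K; apply H; apply Ceq_minus in K; symmetry; exact K. Qed.

(** * The Lambert series *)

Section LambertSeries.
Variables (q : C) (Hq : Cmod q < 1).

(** Up to sign, the logarithmic derivative [w d/dw] of the infinite product of the factors
    [1 - q ^ n * w]. The index starts at 0, so that the poles are at [q ^ (- n)] for [n >= 0]. *)
Definition lambert (w : C) : C := Csum (fun n => (q ^ n * w / (1 - q ^ n * w))%C).

Lemma Cmod_q_pow_mult (n : nat) (w : C) : Cmod (q ^ n * w) = Cmod q ^ n * Cmod w.
Proof. rewrite Cmod_mult, Cmod_pow; reflexivity. Qed.

Lemma Cmod_q_pow_le_1 (n : nat) : 0 <= Cmod q ^ n <= 1.
Proof.
pose proof (Cmod_ge_0 q); split; [apply pow_le; assumption |].
rewrite <- (pow1 n); apply pow_incr; lra.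
Qed.

(** Since [q ^ n * w] tends to 0, the denominators are eventually at least [1 / 2] in modulus; the
    finitely many others have a positive minimum. *)
Lemma lambert_denominator_bound (w : C) :
  (forall n, (q ^ n * w)%C <> 1%C) ->
  exists c, 0 < c /\ forall n, c <= Cmod (1 - q ^ n * w).
Proof.
intros Hw.
assert (Hpos : forall n, 0 < Cmod (1 - q ^ n * w)) by (intros n; apply Cmod_gt_0, C1_minus_neq_0, Hw).
assert (Hfin : forall N, exists c, 0 < c /\ forall n, (n < N)%nat -> c <= Cmod (1 - q ^ n * w)).
{ induction N as [| N (c & Hc & IH)]; [exists 1; split; [lra | intros; lia] |].
  exists (Rmin c (Cmod (1 - q ^ N * w))); split; [apply Rmin_glb_lt; auto |].
  intros n Hn; destruct (Nat.eq_dec n N) as [-> | Hne]; [apply Rmin_r |].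
  eapply Rle_trans; [apply Rmin_l | apply IH; lia]. }
pose proof (Cmod_ge_0 q) as Pq; pose proof (Cmod_ge_0 w) as Pw.
destruct (pow_lt_1_zero (Cmod q)) with (y := / (2 * (Cmod w + 1))) as [N HN].
{ rewrite Rabs_pos_eq; assumption. }
{ apply Rinv_0_lt_compat; lra. }
destruct (Hfin N) as (c & Hc & HcN).
exists (Rmin c (1 / 2)); split; [apply Rmin_glb_lt; lra |].
intros n; destruct (Nat.lt_ge_cases n N) as [L | L].
- eapply Rle_trans; [apply Rmin_l | apply HcN, L].
- eapply Rle_trans; [apply Rmin_r |].
  specialize (HN n L); rewrite Rabs_pos_eq in HN by apply Cmod_q_pow_le_1.
  assert (B : Cmod (q ^ n * w) <= 1 / 2).
  { rewrite Cmod_q_pow_mult.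
    replace (1 / 2) with (/ (2 * (Cmod w + 1)) * (Cmod w + 1)) by (field; lra).
    pose proof (Cmod_q_pow_le_1 n); apply Rmult_le_compat; lra. }
  assert (T := Cmod_triangle (1 - q ^ n * w) (q ^ n * w)).
  replace (1 - q ^ n * w + q ^ n * w)%C with (RtoC 1) in T by ring.
  rewrite Cmod_1 in T; lra.
Qed.

Lemma lambert_dominated (w : C) (c : R) :
  0 < c -> (forall n, c <= Cmod (1 - q ^ n * w)) ->
  forall n, Cmod (q ^ n * w / (1 - q ^ n * w)) <= (Cmod w / c) * Cmod q ^ n.
Proof.
intros Hc H n.
assert (Hn : (1 - q ^ n * w)%C <> 0%C) by (apply Cmod_gt_0; specialize (H n); lra).
rewrite Cmod_div by exact Hn; rewrite Cmod_q_pow_mult.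
replace (Cmod w / c * Cmod q ^ n) with (Cmod q ^ n * Cmod w * / c) by (field; lra).
apply Rmult_le_compat_l.
- apply Rmult_le_pos; [apply Cmod_q_pow_le_1 | apply Cmod_ge_0].
- apply Rinv_le_contravar; auto.
Qed.

Lemma lambert_functional_equation (w : C) :
  (forall n, (q ^ n * w)%C <> 1%C) -> lambert w = (w / (1 - w) + lambert (q * w))%C.
Proof.
intros Hw; destruct (lambert_denominator_bound Hw) as (c & Hc & H).
assert (Hr : 0 <= Cmod q < 1) by (split; [apply Cmod_ge_0 | exact Hq]).
unfold lambert; rewrite (Csum_incr_1 Hr (lambert_dominated Hc H)).
f_equal.
- simpl; rewrite Cmult_1_l; reflexivity.
- apply Csum_ext; intros n.
  replace (q ^ S n * w)%C with (q ^ n * (q * w))%C by (simpl; ring); reflexivity.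
Qed.

(** Termwise differentiation: the remainder of each term at second order is an explicit fraction,
    and its geometric bound is uniform for [v] near [w], so the remainders sum to
    [O(Cmod (v - w) ^ 2)]. *)
Lemma lambert_derive (w : C) :
  (forall n, (q ^ n * w)%C <> 1%C) -> exists l, Cderiv_at lambert w l.
Proof.
intros Hw; destruct (lambert_denominator_bound Hw) as (c & Hc & H).
assert (Hr : 0 <= Cmod q < 1) by (split; [apply Cmod_ge_0 | exact Hq]).
set (l n := (q ^ n / ((1 - q ^ n * w) * (1 - q ^ n * w)))%C).
exists (Csum l); intros eps Heps.
(* [K] bounds the inverse of the denominator of the remainder, which has two factors at least [c]
   and one, at [v], at least [c / 2]. [B] is what [Cmod_Csum_le] makes of [K]. *)
set (K := 2 / (c * c * c)).
assert (HK : 0 < K) by (apply Rdiv_lt_0_compat; [lra | repeat apply Rmult_lt_0_compat; assumption]).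
set (B := 2 * K / (1 - Cmod q)).
assert (HB : 0 < B) by (apply Rdiv_lt_0_compat; lra).
exists (Rmin (c / 2) (eps / B)); split.
{ apply Rmin_glb_lt; [lra | apply Rdiv_lt_0_compat; assumption]. }
intros v Hv.
assert (Hv1 := Rlt_le_trans _ _ _ Hv (Rmin_l _ _)).
assert (Hv2 := Rlt_le_trans _ _ _ Hv (Rmin_r _ _)).
pose proof (Cmod_ge_0 (v - w)) as Pv.
assert (H' : forall n, c / 2 <= Cmod (1 - q ^ n * v)).
{ intros n; specialize (H n).
  assert (T := Cmod_triangle (1 - q ^ n * v) (q ^ n * (v - w))).
  replace (1 - q ^ n * v + q ^ n * (v - w))%C with (1 - q ^ n * w)%C in T by ring.
  rewrite Cmod_q_pow_mult in T; pose proof (Cmod_q_pow_le_1 n); nra. }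
assert (Hc2 : 0 < c / 2) by lra.
assert (Dv := lambert_dominated Hc2 H'); assert (Dw := lambert_dominated Hc H).
assert (Hn0 : forall n, (1 - q ^ n * w)%C <> 0%C)
  by (intros n; apply Cmod_gt_0; specialize (H n); lra).
assert (Hn1 : forall n, (1 - q ^ n * v)%C <> 0%C)
  by (intros n; apply Cmod_gt_0; specialize (H' n); lra).
assert (Dl : forall n, Cmod (l n) <= / (c * c) * Cmod q ^ n).
{ intros n; unfold l; rewrite Cmod_div by (apply Cmult_neq_0; apply Hn0).
  rewrite Cmod_mult, Cmod_pow, (Rmult_comm (/ (c * c))).
  apply Rmult_le_compat_l; [apply Cmod_q_pow_le_1 |].
  apply Rinv_le_contravar; [nra |]; specialize (H n); nra. }
assert (Dlv : forall n, Cmod ((v - w) * l n) <= Cmod (v - w) * / (c * c) * Cmod q ^ n).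
{ intros n; rewrite Cmod_mult, Rmult_assoc; apply Rmult_le_compat_l; [exact Pv | apply Dl]. }
assert (Dvw : forall n, Cmod (q ^ n * v / (1 - q ^ n * v) - q ^ n * w / (1 - q ^ n * w))
   <= (Cmod v / (c / 2) + Cmod w / c) * Cmod q ^ n).
{ intros n; eapply Rle_trans; [apply Cmod_triangle_sub |].
  rewrite Rmult_plus_distr_r; apply Rplus_le_compat; [apply Dv | apply Dw]. }
unfold lambert.
rewrite <- (Csum_scal Hr (v - w) Dl), <- (Csum_minus Hr Dv Dw), <- (Csum_minus Hr Dvw Dlv).
eapply Rle_trans.
{ apply (Cmod_Csum_le Hr) with (M := K * (Cmod (v - w) * Cmod (v - w))).
  intros n.
  replace (q ^ n * v / (1 - q ^ n * v) - q ^ n * w / (1 - q ^ n * w) - (v - w) * l n)%C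
    with (q ^ n * ((v - w) * (v - w)) * q ^ n
          / ((1 - q ^ n * w) * (1 - q ^ n * w) * (1 - q ^ n * v)))%C
    by (unfold l; field; split; [apply Hn0 | apply Hn1]).
  rewrite Cmod_div by (repeat apply Cmult_neq_0; auto).
  rewrite !Cmod_mult, !Cmod_pow.
  pose proof (Cmod_q_pow_le_1 n) as Q; set (Qn := Cmod q ^ n) in *.
  set (V := Cmod (v - w) * Cmod (v - w)).
  assert (0 <= V) by (unfold V; nra).
  replace (K * V * Qn) with (Qn * V * 1 * K) by ring.
  unfold Rdiv; apply Rmult_le_compat.
  - repeat apply Rmult_le_pos; lra.
  - apply Rlt_le, Rinv_0_lt_compat; repeat apply Rmult_lt_0_compat; apply Cmod_gt_0; auto.
  - apply Rmult_le_compat_l; [apply Rmult_le_pos; lra | lra].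
  - replace K with (/ (c * c * (c / 2))) by (unfold K; field; lra).
    specialize (H n); specialize (H' n).
    apply Rinv_le_contravar; [repeat apply Rmult_lt_0_compat; lra |].
    apply Rmult_le_compat; [nra | lra | | exact H'].
    apply Rmult_le_compat; lra. }
replace (2 * (K * (Cmod (v - w) * Cmod (v - w))) * / (1 - Cmod q))
  with (B * Cmod (v - w) * Cmod (v - w)) by (unfold B; field; lra).
apply Rmult_le_compat_r; [exact Pv |].
apply Rmult_lt_compat_l with (r := B) in Hv2; [| exact HB].
replace (B * (eps / B)) with eps in Hv2 by (field; lra); lra.
Qed.

End LambertSeries.

(* For the lattice of periods a and tau a: up to scaling and a linear term,
   quasi_zeta is the Weierstrass zeta function, and the product formula for theta
   functions gives it as a Lambert series in exp (2 pi i z / a). *)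
Section QuasiPeriodicFunction.
Variables (a tau : C) (Ha : a <> 0%C) (Htau : 0 < Im tau).

Let q : C := exp2pii tau.

Let Hq : Cmod q < 1.
Proof.
unfold q, exp2pii; rewrite Cmod_Cexp, <- exp_0; apply exp_increasing.
destruct tau as [x y]; unfold Im in Htau; unfold two_pi_i, Re; simpl in *.
pose proof PI_RGT_0; nra.
Qed.

(** With [w = exp2pii (z / a)], the second argument is [q / w]: its series has poles at the positive
    powers of [q], the first at the others, so that each lattice point is a pole of exactly one
    term. *)
Definition quasi_zeta (z : C) : C :=
  (lambert q (exp2pii (z / a)) - lambert q (exp2pii (tau - z / a)))%C.

Definition off_lattice (z : C) : Prop :=
  forall m n : Z, z <> (RtoC (IZR m) * a + RtoC (IZR n) * (tau * a))%C.

Lemma off_lattice_exp (z : C) (k : Z) :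
  off_lattice z -> exp2pii (z / a + RtoC (IZR k) * tau) <> 1%C.
Proof.
intros Hz H; destruct (exp2pii_eq_1 H) as [m Hm].
apply (Hz m (- k)%Z).
replace z with ((z / a + RtoC (IZR k) * tau) * a - RtoC (IZR k) * tau * a)%C
  by (field; exact Ha).
rewrite Hm, opp_IZR, RtoC_opp; ring.
Qed.

Lemma off_lattice_pow (z : C) : off_lattice z ->
  forall n : nat, (q ^ n * exp2pii (z / a))%C <> 1%C.
Proof.
intros Hz n; unfold q; rewrite <- exp2pii_nat_mult, <- exp2pii_plus, Cplus_comm, INR_IZR_INZ.
apply off_lattice_exp, Hz.
Qed.

Lemma off_lattice_opp (z : C) : off_lattice z -> off_lattice (- z).
Proof.
intros Hz m n H; apply (Hz (- m)%Z (- n)%Z).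
replace z with (- - z)%C by ring.
rewrite H, !opp_IZR, !RtoC_opp; ring.
Qed.

Lemma off_lattice_add (z : C) (m n : Z) : off_lattice z ->
  off_lattice (z + (RtoC (IZR m) * a + RtoC (IZR n) * (tau * a))).
Proof.
intros Hz m' n' H; apply (Hz (m' - m)%Z (n' - n)%Z).
rewrite !minus_IZR, !RtoC_minus.
replace z with (z + (RtoC (IZR m) * a + RtoC (IZR n) * (tau * a))
  - (RtoC (IZR m) * a + RtoC (IZR n) * (tau * a)))%C by ring.
rewrite H; ring.
Qed.

Lemma off_lattice_pow_opp (z : C) : off_lattice z ->
  forall n : nat, (q ^ n * exp2pii (- (z / a)))%C <> 1%C.
Proof.
intros Hz; replace (- (z / a))%C with (- z / a)%C by (field; exact Ha).
apply off_lattice_pow, off_lattice_opp, Hz.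
Qed.

Lemma off_lattice_pow_tau (z : C) : off_lattice z ->
  forall n : nat, (q ^ n * exp2pii (tau - z / a))%C <> 1%C.
Proof.
intros Hz n H; apply (off_lattice_pow_opp Hz (n := S n)); rewrite <- H.
unfold Cminus; rewrite exp2pii_plus; fold q; simpl; ring.
Qed.

Lemma quasi_zeta_derive (z : C) : off_lattice z -> exists l, Cderiv_at quasi_zeta z l.
Proof.
intros Hz.
assert (A1 : Cderiv_at (fun z => z / a)%C z (/ a)).
{ eapply Cderiv_at_ext_loc; [| apply (Cderiv_at_affine (/ a) 0)].
  exists 1; split; [lra |]; intros w _; field; exact Ha. }
assert (A2 : Cderiv_at (fun z => tau - z / a)%C z (- / a)).
{ eapply Cderiv_at_ext_loc; [| apply (Cderiv_at_affine (- / a) tau)].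
  exists 1; split; [lra |]; intros w _; field; exact Ha. }
destruct (exp2pii_derive (z / a)) as [e1 E1].
destruct (exp2pii_derive (tau - z / a)) as [e2 E2].
destruct (lambert_derive Hq (off_lattice_pow Hz)) as [l1 L1].
destruct (lambert_derive Hq (off_lattice_pow_tau Hz)) as [l2 L2].
eexists; apply Cderiv_at_minus.
- exact (Cderiv_at_comp (Cderiv_at_comp A1 E1) L1).
- exact (Cderiv_at_comp (Cderiv_at_comp A2 E2) L2).
Qed.

Lemma quasi_zeta_add_a (z : C) : quasi_zeta (z + a) = quasi_zeta z.
Proof.
unfold quasi_zeta.
replace ((z + a) / a)%C with (z / a + 1)%C by (field; exact Ha).
rewrite (exp2pii_plus (z / a)), exp2pii_1, Cmult_1_r.
replace (tau - z / a)%C with (tau - (z / a + 1) + 1)%C by ring.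
rewrite (exp2pii_plus _ 1), exp2pii_1, Cmult_1_r; reflexivity.
Qed.

(** The translation multiplies [w] by [q]: the first series loses its term [w / (1 - w)], the second
    gains the term at [/ w], and these two terms sum to [- 1]. *)
Lemma quasi_zeta_add_tau (z : C) : off_lattice z ->
  quasi_zeta (z + tau * a) = (quasi_zeta z + 1)%C.
Proof.
intros Hz; unfold quasi_zeta.
replace ((z + tau * a) / a)%C with (tau + z / a)%C by (field; exact Ha).
replace (tau - (tau + z / a))%C with (- (z / a))%C by ring.
unfold Cminus at 3; rewrite !exp2pii_plus; fold q.
rewrite (lambert_functional_equation Hq (off_lattice_pow Hz)).
rewrite (lambert_functional_equation Hq (off_lattice_pow_opp Hz)).
pose proof (@exp2pii_neq_0 (z / a)) as H0.
pose proof (off_lattice_pow Hz (n := 0)) as H1.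
simpl in H1; rewrite Cmult_1_l in H1.
rewrite exp2pii_opp.
set (w := exp2pii (z / a)) in *.
assert (E : (w / (1 - w) + / w / (1 - / w) = - (1))%C).
{ field; repeat split.
  - exact H0.
  - intro K; apply H1; apply Ceq_minus; exact K.
  - apply C1_minus_neq_0, H1. }
replace (lambert q (q * w) - (/ w / (1 - / w) + lambert q (q * / w)))%C
  with (lambert q (q * w) - lambert q (q * / w) + w / (1 - w) - (w / (1 - w) + / w / (1 - / w)))%C
  by ring.
rewrite E; ring.
Qed.

Lemma quasi_zeta_add_tau_Z (n : Z) (z : C) : off_lattice z ->
  quasi_zeta (z + RtoC (IZR n) * (tau * a)) = (quasi_zeta z + RtoC (IZR n))%C.
Proof.
revert z.
assert (P : forall (n : nat) z, off_lattice z ->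
  quasi_zeta (z + RtoC (INR n) * (tau * a)) = (quasi_zeta z + RtoC (INR n))%C).
{ induction n0 as [| k IH]; intros z Hz.
  - change (INR 0) with 0; rewrite Cmult_0_l, !Cplus_0_r; reflexivity.
  - rewrite S_INR, RtoC_plus.
    replace (z + (RtoC (INR k) + 1) * (tau * a))%C
      with (z + RtoC (INR k) * (tau * a) + tau * a)%C by ring.
    rewrite quasi_zeta_add_tau, IH by
     (try exact Hz; replace (z + RtoC (INR k) * (tau * a))%C
       with (z + (RtoC (IZR 0) * a + RtoC (IZR (Z.of_nat k)) * (tau * a)))%C
       by (rewrite <- INR_IZR_INZ; ring); apply off_lattice_add, Hz).
    ring. }
destruct n as [| p | p]; intros z Hz.
- rewrite Cmult_0_l, !Cplus_0_r; reflexivity.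
- rewrite <- positive_nat_Z, <- INR_IZR_INZ; apply P, Hz.
- change (Z.neg p) with (- Z.pos p)%Z; rewrite opp_IZR, RtoC_opp.
  rewrite <- positive_nat_Z, <- INR_IZR_INZ.
  set (k := Pos.to_nat p).
  assert (Hz' : off_lattice (z + - RtoC (INR k) * (tau * a))).
  { replace (z + - RtoC (INR k) * (tau * a))%C
       with (z + (RtoC (IZR 0) * a + RtoC (IZR (- Z.of_nat k)) * (tau * a)))%C
       by (rewrite opp_IZR, RtoC_opp, <- INR_IZR_INZ; ring).
    apply off_lattice_add, Hz. }
  (* A negative multiple is undone by the positive case at the translated point. *)
  pose proof (P k _ Hz') as H.
  replace (z + - RtoC (INR k) * (tau * a) + RtoC (INR k) * (tau * a))%C with z in H by ring.
  rewrite H; ring.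
Qed.

Lemma quasi_zeta_add_a_Z (m : Z) (z : C) :
  quasi_zeta (z + RtoC (IZR m) * a) = quasi_zeta z.
Proof.
assert (P : forall (n : nat) z, quasi_zeta (z + RtoC (INR n) * a) = quasi_zeta z).
{ induction n as [| k IH]; intros z'.
  - change (INR 0) with 0; rewrite Cmult_0_l, Cplus_0_r; reflexivity.
  - rewrite S_INR, RtoC_plus, <- (IH z'), <- (quasi_zeta_add_a (z' + RtoC (INR k) * a)).
    f_equal; ring. }
destruct m as [| p | p].
- rewrite Cmult_0_l, Cplus_0_r; reflexivity.
- rewrite <- positive_nat_Z, <- INR_IZR_INZ; apply P.
- change (Z.neg p) with (- Z.pos p)%Z; rewrite opp_IZR, RtoC_opp.
  rewrite <- positive_nat_Z, <- INR_IZR_INZ.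
  rewrite <- (P (Pos.to_nat p)); f_equal; ring.
Qed.

End QuasiPeriodicFunction.

(** The sign [s] records the orientation of the basis: the Lambert series needs [tau] in the upper
    half plane, so [tau] is [omega2 / omega1] or its negative. The increment along [omega2] is then
    [s]. *)
Lemma quasi_periodic_function_exists (L : lattice) :
  exists (zeta : C -> C) (s : R), (s = 1 \/ s = -1) /\
    (forall z, ~ in_lattice L z -> exists l, Cderiv_at zeta z l) /\
    (forall z m n, ~ in_lattice L z ->
       zeta (z + (RtoC (IZR m) * omega1 L + RtoC (IZR n) * omega2 L))%C = (zeta z + RtoC (s * IZR n))%C).
Proof.
set (w1 := omega1 L); set (w2 := omega2 L).
assert (H1 : w1 <> 0%C).
{ intro K; destruct (@omega_indep L 1 0) as [E _]; [| lra].
  fold w1 w2; rewrite K; ring. }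
assert (Him : Im (w2 / w1) <> 0).
{ intro K; destruct (@omega_indep L (- Re (w2 / w1)) 1) as [_ E]; [| lra].
  fold w1 w2; rewrite RtoC_opp.
  replace (RtoC (Re (w2 / w1))) with (w2 / w1)%C by (apply injective_projections; [reflexivity | exact K]).
  field; exact H1. }
assert (Hmain : forall (s : Z), (s = 1 \/ s = -1)%Z -> 0 < Im (RtoC (IZR s) * (w2 / w1)) ->
  exists zeta : C -> C, (forall z, ~ in_lattice L z -> exists l, Cderiv_at zeta z l) /\
    (forall z m n, ~ in_lattice L z ->
       zeta (z + (RtoC (IZR m) * w1 + RtoC (IZR n) * w2))%C = (zeta z + RtoC (IZR s * IZR n))%C)).
{ intros s Hs Hpos; set (tau := (RtoC (IZR s) * (w2 / w1))%C) in *.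
  assert (Ess : (s * s = 1)%Z) by (destruct Hs; subst; reflexivity).
  assert (Et : (tau * w1 = RtoC (IZR s) * w2)%C) by (unfold tau; field; exact H1).
  assert (Hoff : forall z, ~ in_lattice L z -> off_lattice w1 tau z).
  { intros z Hz m n E; apply Hz; exists m, (n * s)%Z; fold w1 w2.
    rewrite E, Et, mult_IZR, RtoC_mult; ring. }
  exists (quasi_zeta w1 tau); split; [intros z Hz; apply quasi_zeta_derive; auto |].
  intros z m n Hz.
  replace (z + (RtoC (IZR m) * w1 + RtoC (IZR n) * w2))%C
    with (z + RtoC (IZR (s * n)) * (tau * w1) + RtoC (IZR m) * w1)%C.
  - rewrite quasi_zeta_add_a_Z by exact H1.
    rewrite quasi_zeta_add_tau_Z by auto.
    rewrite mult_IZR; reflexivity.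
  - rewrite Et.
    replace (RtoC (IZR (s * n)) * (RtoC (IZR s) * w2))%C with (RtoC (IZR (s * s * n)) * w2)%C
      by (rewrite !mult_IZR, !RtoC_mult; ring).
    rewrite Ess, Z.mul_1_l; ring. }
destruct (Rtotal_order (Im (w2 / w1)) 0) as [Hneg | [H0 | Hpos]]; [| contradiction |].
- destruct (Hmain (-1)%Z) as (zeta & Hzeta); [auto | rewrite im_scal_l; lra |].
  exists zeta, (-1); split; [auto | exact Hzeta].
- destruct (Hmain 1%Z) as (zeta & Hzeta); [auto | rewrite im_scal_l; lra |].
  exists zeta, 1; split; [auto | exact Hzeta].
Qed.

(** * Degeneration at page two from a contracting homotopy *)

Section AltLemmas.
Variable G : AbelianGroup.

Lemma alt_zero (n : nat) : alt n (zero : G) = zero.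
Proof. unfold alt; destruct (Nat.even n); [reflexivity | apply opp_zero]. Qed.

Lemma alt_involutive (n : nat) (x : G) : alt n (alt n x) = x.
Proof. unfold alt; destruct (Nat.even n); [reflexivity | apply opp_opp]. Qed.

Lemma plus_eq_zero_l (x y : G) : plus x y = zero -> x = opp y.
Proof.
intros H; rewrite <- (plus_zero_r x), <- (plus_opp_r y), plus_assoc, H; apply plus_zero_l.
Qed.

Lemma minus_zero_l (x : G) : minus zero x = opp x.
Proof. apply plus_zero_l. Qed.

End AltLemmas.

Section DoubleComplex.
Variables (W : AbelianGroup) (K : nat -> nat -> W -> Prop) (dh dv s : W -> W).
(** The axioms are relative to [K p q] because the de Rham differential is additive and squares to
    zero only on suitably holomorphic cochains. The homotopy [s] leads from column [p + 2] to column
    [p + 1], so never into column 0, and [dh_s] concerns closed elements. *)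
Hypothesis K_zero : forall p q, K p q zero.
Hypothesis K_minus : forall p q x y, K p q x -> K p q y -> K p q (minus x y).
Hypothesis dh_minus : forall p q x y, K p q x -> K p q y ->
  dh (minus x y) = minus (dh x) (dh y).
Hypothesis dv_minus : forall p q x y, K p q x -> K p q y ->
  dv (minus x y) = minus (dv x) (dv y).
Hypothesis dh_dh : forall p q x, K p q x -> dh (dh x) = zero.
Hypothesis dv_dh : forall p q x, K p q x -> dv (dh x) = dh (dv x).
Hypothesis K_dv : forall p q x, K p q x -> K p (S q) (dv x).
Hypothesis K_s : forall p q x, K (S (S p)) q x -> K (S p) q (s x).
Hypothesis s_zero : s zero = zero.
Hypothesis dv_s : forall p q x, K p q x -> dv (s x) = s (dv x).
Hypothesis dh_s : forall p q x, K (S (S p)) q x -> dh x = zero -> dh (s x) = x.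

Lemma dh_zero : dh zero = zero.
Proof.
pose proof (dh_minus (K_zero 0 0) (K_zero 0 0)) as H; rewrite !minus_eq_zero in H; exact H.
Qed.

Lemma dv_zero : dv zero = zero.
Proof.
pose proof (dv_minus (K_zero 0 0) (K_zero 0 0)) as H; rewrite !minus_eq_zero in H; exact H.
Qed.

Lemma K_opp p q x : K p q x -> K p q (opp x).
Proof.
intros H; rewrite <- (minus_zero_l x); exact (K_minus (K_zero p q) H).
Qed.

Lemma K_alt p q n x : K p q x -> K p q (alt n x).
Proof. intros H; unfold alt; destruct (Nat.even n); [exact H | apply K_opp, H]. Qed.

Lemma K_of_alt p q n x : K p q (alt n x) -> K p q x.
Proof. intros H; rewrite <- (alt_involutive n x); apply K_alt, H. Qed.

Lemma K_of_plus p q (x y : W) : K p q x -> K p q (plus x y) -> K p q y.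
Proof.
intros Hx H; replace y with (minus (plus x y) x); [apply K_minus; assumption |].
unfold minus; rewrite (plus_comm x y); etransitivity; [symmetry; apply plus_assoc |].
etransitivity; [apply f_equal, plus_opp_r | apply plus_zero_r].
Qed.

Lemma dh_opp p q x : K p q x -> dh (opp x) = opp (dh x).
Proof.
intros H; pose proof (dh_minus (K_zero p q) H) as E.
rewrite dh_zero, !minus_zero_l in E; exact E.
Qed.

Lemma dh_alt p q n x : K p q x -> dh (alt n x) = alt n (dh x).
Proof. intros H; unfold alt; destruct (Nat.even n); [reflexivity | eapply dh_opp, H]. Qed.

(** A zigzag with entries at [(p, q)] and [(p + 1, q - 1)]. Testing [S b] against [q] avoids
    truncated subtraction: for [q = 0] the second entry is absent. *)
Definition two_step (p q : nat) (x0 x1 : W) (a b : nat) : W :=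
  if andb (Nat.eqb a p) (Nat.eqb b q) then x0
  else if andb (Nat.eqb a (S p)) (Nat.eqb (S b) q) then x1 else zero.

(** The hypotheses say that every component of the total differential of the zigzag vanishes, so a
    single witness serves for all [r]. *)
Lemma Zcyc_two_step p q x0 x1 :
  K p q x0 -> (forall q', q = S q' -> K (S p) q' x1) -> dv x0 = zero ->
  (q = O -> dh x0 = zero) ->
  (forall q', q = S q' -> plus (dv x1) (alt q (dh x0)) = zero /\ dh x1 = zero) ->
  forall r, Zcyc K dh dv r p q x0.
Proof.
intros K0 K1 Hv Hq0 Hq1 r; exists (two_step p q x0 x1).
assert (HD : forall a b, Dtot dh dv (two_step p q x0 x1) a b = zero).
{ intros a b; unfold Dtot, two_step; destruct a as [| a], b as [| b];
    repeat match goal with |- context [Nat.eqb ?m ?n] =>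
      destruct (Nat.eqb_spec m n); cbn [andb]; cbv iota; try lia end;
    subst; rewrite ?dv_zero, ?dh_zero, ?alt_zero, ?plus_zero_l, ?plus_zero_r;
    try reflexivity; try assumption.
  all: try (rewrite Hq0 by lia; apply alt_zero).
  all: try (edestruct Hq1 as [E1 E2]; [reflexivity |]; try exact E1; rewrite E2; apply alt_zero). }
split; [split; [| split; [| split]] |].
- intros a b; unfold two_step.
  destruct (Nat.eqb_spec a p), (Nat.eqb_spec b q); cbn [andb]; cbv iota;
    destruct (Nat.eqb_spec a (S p)), (Nat.eqb_spec (S b) q); cbn [andb]; cbv iota;
    try lia; subst; (split; [auto | intros; try reflexivity; lia]).
- intros a b Hab; unfold two_step.
  destruct (Nat.eqb_spec a p), (Nat.eqb_spec a (S p)); try lia; reflexivity.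
- intros a b; rewrite HD; split; [apply K_zero | reflexivity].
- intros a b _; apply HD.
- unfold two_step; rewrite !Nat.eqb_refl; reflexivity.
Qed.

(** Let [x1] be the entry of the witness in column [p + 1]. What prevents cutting the zigzag there
    is [y = dh x1], in column [p + 2]. It is closed for both differentials, so replacing [x1] by
    [x1 - s y] makes the horizontal differential vanish and leaves the vertical one unchanged. *)
Lemma Zcyc_2_permanent p q x : Zcyc K dh dv 2 p q x -> forall r, Zcyc K dh dv r p q x.
Proof.
intros (X & (HT & HF & HDT & HDF) & ->).
assert (Kx : K p q (X p q)) by apply HT.
assert (Hv : dv (X p q) = zero).
{ assert (E : Dtot dh dv X p (S q) = zero) by (apply HDF; lia).
  unfold Dtot in E; destruct p as [| p']; [rewrite plus_zero_r in E; exact E |].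
  rewrite (HF p' (S q)), dh_zero, alt_zero, plus_zero_r in E by lia; exact E. }
assert (E1 : Dtot dh dv X (S p) q = zero) by (apply HDF; lia).
unfold Dtot in E1.
destruct q as [| q'].
- rewrite plus_zero_l in E1.
  apply (@Zcyc_two_step p 0 _ zero); [exact Kx | intros; discriminate | exact Hv | | intros; discriminate].
  intros _; rewrite <- (alt_involutive 0 (dh (X p 0%nat))), E1; apply alt_zero.
- set (x1 := X (S p) q') in *.
  assert (K1 : K (S p) q' x1) by apply HT.
  set (y := dh x1).
  assert (Ky : K (S (S p)) q' y).
  (* [y] is, up to sign, a component of [Dtot X] minus a vertical differential, both of which lie in
     [K]. *)
  { apply K_of_alt with q'.
    pose proof (proj1 (HDT (S (S p)) q')) as H; unfold Dtot in H; fold x1 y in H.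
    apply K_of_plus with (2 := H); destruct q'; [apply K_zero | apply K_dv, HT]. }
  assert (Hy : dh y = zero) by (eapply dh_dh, K1).
  assert (Kdhx : K (S p) (S q') (dh (X p (S q')))).
  { apply K_of_alt with (S q'); apply K_of_plus with (dv x1); [apply K_dv, K1 |].
    rewrite E1; apply K_zero. }
  assert (Hvy : dv y = zero).
  { unfold y; rewrite (dv_dh K1), (plus_eq_zero_l E1).
    rewrite (dh_opp (K_alt (S q') Kdhx)), (dh_alt _ Kdhx), (dh_dh Kx), alt_zero.
    apply opp_zero. }
  assert (Ksy : K (S p) q' (s y)) by (apply K_s, Ky).
  apply (@Zcyc_two_step p (S q') _ (minus x1 (s y))).
  + exact Kx.
  + intros q'' [= <-]; apply K_minus; assumption.
  + exact Hv.
  + intros; discriminate.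
  + intros q'' [= <-]; split.
    * rewrite (dv_minus K1 Ksy), (dv_s Ky), Hvy, s_zero.
      etransitivity; [apply f_equal2; [apply minus_zero_r | reflexivity] | exact E1].
    * rewrite (dh_minus K1 Ksy), (dh_s Ky Hy); apply plus_opp_r.
Qed.

(** In degree [(p, q)] only columns [p - 1] and [p] of [X] contribute. If [w] is the contribution of
    column [p - 1], that column may be replaced by [s w] and everything before it by 0:
    [dh (s w) = w] preserves the boundary, and [dv (s w) = 0] creates nothing new in column
    [p - 1]. *)
Lemma Bbd_from_page_2 r p q x : Bbd K dh dv r p q x -> Bbd K dh dv 2 p q x.
Proof.
intros (X & HT & _ & HDT & HDF & Ex).
destruct p as [| [| p0]].
(* For [p <= 1] the filtration condition at [r = 2] starts at [p - 1 <= 0], hence is void. *)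
- exists X; repeat split; try apply HT; try apply HDT; try exact HDF; try exact Ex.
  intros a b Hab; lia.
- exists X; repeat split; try apply HT; try apply HDT; try exact HDF; try exact Ex.
  intros a b Hab; lia.
- set (x1 := X (S p0) q).
  assert (K1 : K (S p0) q x1) by apply HT.
  set (w := dh x1).
  assert (Kw : K (S (S p0)) q w).
  { apply K_of_alt with q.
    pose proof (proj1 (HDT (S (S p0)) q)) as H; unfold Dtot in H; fold x1 w in H.
    apply K_of_plus with (2 := H); destruct q; [apply K_zero | apply K_dv, HT]. }
  assert (Hw : dh w = zero) by (eapply dh_dh, K1).
  assert (E1 : Dtot dh dv X (S p0) (S q) = zero) by (apply HDF; lia).
  unfold Dtot in E1; fold x1 in E1.
  assert (Kx0 : K p0 (S q) (X p0 (S q))) by apply HT.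
  assert (Kdhx : K (S p0) (S q) (dh (X p0 (S q)))).
  { apply K_of_alt with (S q); apply K_of_plus with (dv x1); [apply K_dv, K1 |].
    rewrite E1; apply K_zero. }
  assert (Hvw : dv w = zero).
  { unfold w; rewrite (dv_dh K1), (plus_eq_zero_l E1).
    rewrite (dh_opp (K_alt (S q) Kdhx)), (dh_alt _ Kdhx), (dh_dh Kx0), alt_zero.
    apply opp_zero. }
  assert (Ksw : K (S p0) q (s w)) by (apply K_s, Kw).
  assert (Hvsw : dv (s w) = zero) by (rewrite (dv_s Kw), Hvw; exact s_zero).
  set (X' := fun a b => if Nat.leb a p0 then zero
    else if Nat.eqb a (S p0) then (if Nat.eqb b q then s w else zero) else X a b).
  assert (HD : forall a b, Dtot dh dv X' a b = if Nat.leb a (S p0) then zero else Dtot dh dv X a b).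
  { intros a b; unfold Dtot, X'.
    destruct (Nat.leb_spec a (S p0)) as [L | L].
    - assert (Z1 : match a with O => zero | S p' => alt b (dh (
        if Nat.leb p' p0 then zero else if Nat.eqb p' (S p0) then (if Nat.eqb b q then s w else zero)
        else X p' b)) end = (zero : W)).
      { destruct a as [| a]; [reflexivity |].
        destruct (Nat.leb_spec a p0); [| lia]; rewrite dh_zero; apply alt_zero. }
      etransitivity; [exact (f_equal2 plus eq_refl Z1) |].
      etransitivity; [apply plus_zero_r |]; destruct b as [| b]; [reflexivity |].
      destruct (Nat.leb_spec a p0); [apply dv_zero |].
      destruct (Nat.eqb_spec a (S p0)); [| lia].
      destruct (Nat.eqb_spec b q); [exact Hvsw | apply dv_zero].
    - destruct a as [| a]; [lia |].
      assert (Z1 : Nat.leb (S a) p0 = false) by (apply Nat.leb_gt; lia).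
      assert (Z2 : Nat.leb a p0 = false) by (apply Nat.leb_gt; lia).
      assert (Z3 : Nat.eqb (S a) (S p0) = false) by (apply Nat.eqb_neq; lia).
      rewrite Z1, Z2, Z3; f_equal.
      destruct (Nat.eqb_spec a (S p0)) as [-> | Na]; [| reflexivity].
      destruct (Nat.eqb_spec b q) as [-> | Nb].
      + fold x1; fold w; rewrite (dh_s Kw Hw); reflexivity.
      + rewrite (proj2 (HT (S p0) b)) by lia; reflexivity. }
  exists X'; split; [| split; [| split; [| split]]].
  + intros a b; unfold X'; destruct (Nat.leb_spec a p0); [split; auto |].
    destruct (Nat.eqb_spec a (S p0)) as [-> |]; [| apply HT].
    destruct (Nat.eqb_spec b q) as [-> |]; (split; [auto | intros; try reflexivity; lia]).
  + intros a b Hab; unfold X'; destruct (Nat.leb_spec a p0); [reflexivity | lia].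
  + intros a b; rewrite HD; destruct (Nat.leb_spec a (S p0)); [split; auto | apply HDT].
  + intros a b Hab; rewrite HD; destruct (Nat.leb_spec a (S p0)); [reflexivity | lia].
  + rewrite HD; destruct (Nat.leb_spec (S (S p0)) (S p0)); [lia | exact Ex].
Qed.

Theorem contracting_homotopy_converges_at_page_2 : converges_at_page K dh dv 2.
Proof.
intros p q; unfold page, page_infty.
replace (fun x => forall r, Zcyc K dh dv r p q x) with (Zcyc K dh dv 2 p q).
- replace (fun x => exists r, Bbd K dh dv r p q x) with (Bbd K dh dv 2 p q); [reflexivity |].
  apply functional_extensionality; intros x; apply propositional_extensionality; split.
  + intros H; exists 2%nat; exact H.
  + intros [r H]; exact (Bbd_from_page_2 H).
- apply functional_extensionality; intros x; apply propositional_extensionality; split.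
  + apply Zcyc_2_permanent.
  + intros H; apply H.
Qed.


Lemma dv_opp p q x : K p q x -> dv (opp x) = opp (dv x).
Proof.
intros H; pose proof (dv_minus (K_zero p q) H) as E.
rewrite dv_zero, !minus_zero_l in E; exact E.
Qed.

Lemma dv_alt p q n x : K p q x -> dv (alt n x) = alt n (dv x).
Proof. intros H; unfold alt; destruct (Nat.even n); [reflexivity | eapply dv_opp, H]. Qed.

Lemma Dtot_two_step_0 p q x : dv x = zero -> forall a b,
  Dtot dh dv (two_step p q x zero) a b
  = if andb (Nat.eqb a (S p)) (Nat.eqb b q) then alt q (dh x) else zero.
Proof.
intros Hv a b; unfold Dtot, two_step; destruct a as [| a], b as [| b];
  repeat match goal with |- context [Nat.eqb ?m ?n] =>
    destruct (Nat.eqb_spec m n); cbn [andb]; cbv iota; try lia end;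
  subst; rewrite ?dv_zero, ?dh_zero, ?Hv, ?alt_zero, ?plus_zero_l, ?plus_zero_r; reflexivity.
Qed.

Lemma Asys_1_two_step_0 p q x : K p q x -> dv x = zero -> K (S p) q (dh x) ->
  Asys K dh dv 1 (Z.of_nat p) (Z.of_nat (p + q)) (two_step p q x zero).
Proof.
intros Hx Hv Hd; split; [| split; [| split]].
- intros a b; unfold two_step.
  destruct (Nat.eqb_spec a p), (Nat.eqb_spec b q); cbn [andb]; cbv iota;
    destruct (Nat.eqb_spec a (S p)), (Nat.eqb_spec (S b) q); cbn [andb]; cbv iota;
    try lia; subst; (split; [auto | intros; try reflexivity; lia]).
- intros a b Hab; unfold two_step.
  destruct (Nat.eqb_spec a p), (Nat.eqb_spec a (S p)); try lia; reflexivity.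
- intros a b; rewrite Dtot_two_step_0 by exact Hv.
  destruct (Nat.eqb_spec a (S p)), (Nat.eqb_spec b q); cbn [andb]; cbv iota;
    try (split; [apply K_zero | reflexivity]).
  subst; split; [apply K_alt, Hd | intros; lia].
- intros a b Hab; rewrite Dtot_two_step_0 by exact Hv.
  destruct (Nat.eqb_spec a (S p)); [lia | reflexivity].
Qed.

Lemma two_step_first p q x0 x1 : two_step p q x0 x1 p q = x0.
Proof. unfold two_step; rewrite !Nat.eqb_refl; reflexivity. Qed.

Lemma Bbd_zero r p q : Bbd K dh dv r p q zero.
Proof.
assert (E : forall a b, Dtot dh dv (fun _ _ => zero) a b = zero).
{ intros a b; unfold Dtot; destruct a, b;
    rewrite ?dv_zero, ?dh_zero, ?alt_zero, ?plus_zero_l; reflexivity. }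
exists (fun _ _ => zero); split; [| split; [| split; [| split]]].
- intros a b; split; [apply K_zero | reflexivity].
- intros a b _; reflexivity.
- intros a b; rewrite E; split; [apply K_zero | reflexivity].
- intros a b _; apply E.
- rewrite E; reflexivity.
Qed.

Lemma coset_refl r p q x : coset (Bbd K dh dv r p q) x x.
Proof. unfold coset; rewrite minus_eq_zero; apply Bbd_zero. Qed.

(** For [r = 1] the filtration removes column [p] from a bounding [X], so [Bbd] at [(p + 1, q)]
    contains vertical coboundaries only. If [d_1] killed the class of [x], then [alt q (dh x)] would
    lie in it. *)
Lemma d1_nonzero_of_class p q x : K p q x -> dv x = zero -> K (S p) q (dh x) ->
  ~ match q with O => dh x = zero | S q' => exists g, K (S p) q' g /\ dh x = dv g end ->
  page_diff_nonzero K dh dv 1 p q.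
Proof.
intros Hx Hv Hd Hn; exists (coset (Bbd K dh dv 1 p q) x); split.
- exists x; split; [| reflexivity].
  exists (two_step p q x zero); split; [apply Asys_1_two_step_0; assumption |].
  rewrite two_step_first; reflexivity.
- unfold page_diff; replace (p + 1)%nat with (S p) by lia.
  replace (S q - 1)%nat with q by lia.
  intros H; apply Hn; clear Hn.
  assert (HB : Bbd K dh dv 1 (S p) q (alt q (dh x))).
  { replace (alt q (dh x)) with (minus (alt q (dh x)) zero) by apply minus_zero_r.
    change (coset (Bbd K dh dv 1 (S p) q) zero (alt q (dh x))); rewrite <- H.
    exists (two_step p q x zero); split; [apply Asys_1_two_step_0; assumption |].
    rewrite two_step_first, Dtot_two_step_0, !Nat.eqb_refl by exact Hv; cbn [andb]; cbv iota.
    split; apply coset_refl. }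
  destruct HB as (X & HT & HF & _ & _ & E); unfold Dtot in E.
  rewrite (HF p q), dh_zero, alt_zero in E by lia.
  destruct q as [| q'].
  + rewrite plus_zero_l in E; exact E.
  + exists (alt (S q') (X (S p) q')); split; [apply K_alt, HT |].
    rewrite (dv_alt (S q') (proj1 (HT (S p) q'))).
    rewrite plus_zero_r in E; rewrite <- E, alt_involutive; reflexivity.
Qed.

(** If the pages agreed, the class of [x] would be that of a permanent cycle [y]. In row 0 every
    boundary is a horizontal differential, so [dh] kills [x - y]; it also kills [y], hence [x]. *)
Lemma not_converges_at_page_1_of_class p x :
  K (S p) 0 x -> dv x = zero -> K (S (S p)) 0 (dh x) -> dh x <> zero ->
  ~ converges_at_page K dh dv 1.
Proof.
intros Hx Hv Hd Hn Hconv; specialize (Hconv (S p) O); apply Hn.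
assert (H1 : page K dh dv 1 (S p) 0 (coset (Bbd K dh dv 1 (S p) 0) x)).
{ exists x; split; [| reflexivity].
  exists (two_step (S p) 0 x zero); split; [apply Asys_1_two_step_0; assumption |].
  rewrite two_step_first; reflexivity. }
rewrite Hconv in H1; destruct H1 as (y & Hy & E).
destruct (Hy 2%nat) as (Y & (HYT & _ & _ & HYF) & EY).
assert (Ky : K (S p) 0 y) by (rewrite EY; apply HYT).
assert (Hdy : dh y = zero).
{ assert (E1 : Dtot dh dv Y (S (S p)) 0 = zero) by (apply HYF; lia).
  unfold Dtot in E1; rewrite plus_zero_l, <- EY in E1; exact E1. }
pose proof (coset_refl 1 (S p) 0 x) as Hxx; rewrite E in Hxx.
destruct Hxx as [r (X & HXT & _ & _ & _ & EX)].
assert (Hxy : dh (minus x y) = zero).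
{ rewrite EX; unfold Dtot; rewrite plus_zero_l.
  exact (dh_dh (proj1 (HXT p 0%nat))). }
rewrite (dh_minus Hx Ky), Hdy in Hxy.
etransitivity; [symmetry; apply minus_zero_r | exact Hxy].
Qed.

End DoubleComplex.

(** * The Cech-de Rham double complex *)

Section LocalDerivatives.
Variable L : lattice.
Implicit Types (f g : elliptic_curve L -> C) (x : elliptic_curve L).

(** Differentiability at the lifts of the single point [x]; holomorphy on a set is this condition at
    each of its points. *)
Definition holomorphic_at f x : Prop := holomorphic_on (eq x) f.

Lemma holomorphic_on_at (V : elliptic_curve L -> Prop) f :
  holomorphic_on V f <-> forall x, V x -> holomorphic_at f x.
Proof.
split.
- intros H x Vx z Ez; apply H; rewrite <- Ez; exact Vx.
- intros H z Vz; exact (H (proj L z) Vz z eq_refl).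
Qed.

Lemma holomorphic_at_const (c : C) x : holomorphic_at (fun _ => c) x.
Proof. intros z _; apply ex_derive_const. Qed.

Lemma deriv_z_const (c : C) x : deriv_z (fun _ => c) x = RtoC 0.
Proof. apply deriv_z_unique, (@is_derive_const C_AbsRing C_NormedModule). Qed.

Lemma holomorphic_at_plus f g x : holomorphic_at f x -> holomorphic_at g x ->
  holomorphic_at (fun y => f y + g y)%C x.
Proof.
intros Hf Hg z Ez; apply (@ex_derive_plus C_AbsRing C_NormedModule); [apply Hf | apply Hg]; exact Ez.
Qed.

Lemma deriv_z_plus f g x : holomorphic_at f x -> holomorphic_at g x ->
  deriv_z (fun y => f y + g y)%C x = (deriv_z f x + deriv_z g x)%C.
Proof.
intros Hf Hg; apply (@deriv_z_unique L (fun y => f y + g y)%C).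
apply is_C_derive_plus; apply deriv_z_is_derive; assumption.
Qed.

Lemma holomorphic_at_opp f x : holomorphic_at f x -> holomorphic_at (fun y => - f y)%C x.
Proof. intros Hf z Ez; apply (@ex_derive_opp C_AbsRing C_NormedModule), Hf, Ez. Qed.

Lemma deriv_z_opp f x : holomorphic_at f x -> deriv_z (fun y => - f y)%C x = (- deriv_z f x)%C.
Proof.
intros Hf; apply (@deriv_z_unique L (fun y => - f y)%C).
apply (@is_derive_opp C_AbsRing C_NormedModule), deriv_z_is_derive, Hf.
Qed.

Lemma open_E_locally (V : elliptic_curve L -> Prop) (z : C) : open_E V -> V (proj L z) ->
  @locally (AbsRing_UniformSpace C_AbsRing) z (fun w => V (proj L w)).
Proof. intros HV Hz; apply locally_C; exact (HV z Hz). Qed.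

(** Sections are extended by 0, so formulas for them hold only on an open set; this lemma and the
    next transfer local properties across such formulas. *)
Lemma holomorphic_at_ext (V : elliptic_curve L -> Prop) f g x :
  open_E V -> V x -> (forall y, V y -> f y = g y) -> holomorphic_at f x -> holomorphic_at g x.
Proof.
intros HV Vx E Hf z Ez; apply (@ex_derive_ext_loc C_AbsRing C_NormedModule) with (fun w => f (proj L w)).
- eapply filter_imp; [| apply (open_E_locally HV)]; [| rewrite <- Ez; exact Vx].
  intros w; apply E.
- apply Hf, Ez.
Qed.

Lemma deriv_z_ext (V : elliptic_curve L -> Prop) f g x :
  open_E V -> V x -> (forall y, V y -> f y = g y) -> holomorphic_at f x -> deriv_z g x = deriv_z f x.
Proof.
intros HV Vx E Hf; apply deriv_z_unique.
apply (@is_derive_ext_loc C_AbsRing C_NormedModule) with (fun w => f (proj L w)).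
- eapply filter_imp; [| apply (open_E_locally HV)]; [| rewrite proj_lift; exact Vx].
  intros w; apply E.
- apply deriv_z_is_derive, Hf.
Qed.

Lemma alt_fct_holomorphic n f x : holomorphic_at f x ->
  holomorphic_at (fun y => alt (G := C_AbelianGroup) n (f y)) x
  /\ deriv_z (fun y => alt (G := C_AbelianGroup) n (f y)) x
     = alt (G := C_AbelianGroup) n (deriv_z f x).
Proof.
intros H; unfold alt; destruct (Nat.even n); [split; [exact H | reflexivity] |].
split; [apply holomorphic_at_opp, H | apply deriv_z_opp, H].
Qed.

Lemma alternating_sum_holomorphic (F : nat -> elliptic_curve L -> C) n x :
  (forall j, holomorphic_at (F j) x) ->
  holomorphic_at (fun y => sum_n (G := C_AbelianGroup) (fun j => alt j (F j y)) n) x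
  /\ deriv_z (fun y => sum_n (G := C_AbelianGroup) (fun j => alt j (F j y)) n) x
     = sum_n (G := C_AbelianGroup) (fun j => alt j (deriv_z (F j) x)) n.
Proof.
intros HF; induction n as [| n [IH1 IH2]].
- assert (E : (fun y => sum_n (G := C_AbelianGroup) (fun j => alt j (F j y)) 0) = F 0%nat)
    by (apply functional_extensionality; intros y; rewrite sum_O; reflexivity).
  rewrite E, sum_O; split; [apply HF | reflexivity].
- assert (E : (fun y => sum_n (G := C_AbelianGroup) (fun j => alt j (F j y)) (S n))
     = (fun y => sum_n (G := C_AbelianGroup) (fun j => alt j (F j y)) n
                 + alt (G := C_AbelianGroup) (S n) (F (S n) y))%C)
    by (apply functional_extensionality; intros y; rewrite sum_Sn; reflexivity).
  rewrite E, sum_Sn.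
  destruct (alt_fct_holomorphic (S n) (HF (S n))) as [A1 A2]; split.
  + apply holomorphic_at_plus; assumption.
  + rewrite deriv_z_plus by assumption; rewrite IH2, A2; reflexivity.
Qed.

End LocalDerivatives.

(* The first index selects d(theta)^p or dz d(theta)^(p-1), the second 1 or theta. *)
Definition coef (L : lattice) (k : bool * bool) (w : form L) (x : elliptic_curve L) : C :=
  let f := (if fst k then snd w else fst w) x in if snd k then snd f else fst f.

Section Coefficients.
Variable L : lattice.
Implicit Types (k : bool * bool) (v w : form L) (x : elliptic_curve L).

Lemma form_ext v w : (forall k x, coef k v x = coef k w x) -> v = w.
Proof.
intros H; destruct v as [v1 v2], w as [w1 w2]; f_equal;
  apply functional_extensionality; intros x; apply injective_projections.
- exact (H (false, false) x).
- exact (H (false, true) x).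
- exact (H (true, false) x).
- exact (H (true, true) x).
Qed.

Lemma coef_zero k x : coef k (zero : form L) x = RtoC 0.
Proof. destruct k as [[|] [|]]; reflexivity. Qed.

Lemma coef_plus k v w x : coef k (plus v w) x = (coef k v x + coef k w x)%C.
Proof. destruct k as [[|] [|]]; reflexivity. Qed.

Lemma coef_opp k w x : coef k (opp w) x = (- coef k w x)%C.
Proof. destruct k as [[|] [|]]; reflexivity. Qed.

Lemma coef_minus k v w x : coef k (minus v w) x = (coef k v x - coef k w x)%C.
Proof. destruct k as [[|] [|]]; reflexivity. Qed.

Lemma coef_alt k n w x : coef k (alt n w) x = alt (G := C_AbelianGroup) n (coef k w x).
Proof. unfold alt; destruct (Nat.even n); [reflexivity | apply coef_opp]. Qed.

Lemma coef_sum k (F : nat -> form L) n x :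
  coef k (sum_n F n) x = sum_n (G := C_AbelianGroup) (fun j => coef k (F j) x) n.
Proof.
induction n as [| n IH]; [rewrite !sum_O; reflexivity |].
rewrite !sum_Sn, <- IH; apply coef_plus.
Qed.

Lemma coef_restrict_in k (V : elliptic_curve L -> Prop) w x :
  V x -> coef k (restrict_form V w) x = coef k w x.
Proof.
intros Vx; unfold coef, restrict_form, restrict; destruct k as [[|] [|]]; cbn [fst snd];
  destruct (excluded_middle_informative (V x)); tauto || reflexivity.
Qed.

Lemma coef_restrict_out k (V : elliptic_curve L -> Prop) w x :
  ~ V x -> coef k (restrict_form V w) x = RtoC 0.
Proof.
intros Vx; unfold coef, restrict_form, restrict; destruct k as [[|] [|]]; cbn [fst snd];
  destruct (excluded_middle_informative (V x)); tauto || reflexivity.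
Qed.

Definition d_coef w k x : C :=
  match k with
  | (false, false) => coef (false, true) w x
  | (false, true) => RtoC 0
  | (true, false) => deriv_z (coef (false, false) w) x - coef (true, true) w x
  | (true, true) => deriv_z (coef (false, true) w) x
  end%C.

Lemma coef_d_form k w x : coef k (d_form w) x = d_coef w k x.
Proof.
destruct k as [[|] [|]]; try reflexivity.
change (deriv_z (coef (false, true) w) x - RtoC 0 = deriv_z (coef (false, true) w) x)%C; ring.
Qed.

Lemma Omega_iff p (V : elliptic_curve L -> Prop) w : Omega p V w <->
  (forall k x, V x -> holomorphic_at (coef k w) x)
  /\ (forall k x, ~ V x -> coef k w x = RtoC 0) /\ (p = 0%nat -> snd w = zero).
Proof.
unfold Omega, O_SE; rewrite !holomorphic_on_at; split.
- intros ((A0 & A1 & A) & (B0 & B1 & B) & C0); split; [| split; [| exact C0]].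
  + intros [[|] [|]]; assumption.
  + intros [[|] [|]] x Vx; unfold coef; cbn [fst snd];
      first [rewrite (A x Vx) | rewrite (B x Vx)]; reflexivity.
- intros (H & Z & C0); split; [split; [| split] | split; [split; [| split] | exact C0]].
  + exact (H (false, false)).
  + exact (H (false, true)).
  + intros x Vx; apply injective_projections;
      [exact (Z (false, false) x Vx) | exact (Z (false, true) x Vx)].
  + exact (H (true, false)).
  + exact (H (true, true)).
  + intros x Vx; apply injective_projections;
      [exact (Z (true, false) x Vx) | exact (Z (true, true) x Vx)].
Qed.

Lemma snd_form_zero w : snd w = zero <-> forall b x, coef (true, b) w x = RtoC 0.
Proof.
split.
- intros H b x; unfold coef; cbn [fst snd]; rewrite H; destruct b; reflexivity.
- intros H; apply functional_extensionality; intros x; apply injective_projections;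
    [exact (H false x) | exact (H true x)].
Qed.

(* d homotopy + homotopy d is the identity in degrees p >= 2. *)
Definition homotopy w : form L :=
  (fun x => (RtoC 0, coef (false, false) w x), fun x => (RtoC 0, - coef (true, false) w x)%C).

Definition homotopy_coef w k x : C :=
  match k with
  | (false, true) => coef (false, false) w x
  | (true, true) => - coef (true, false) w x
  | _ => RtoC 0
  end%C.

Lemma coef_homotopy k w x : coef k (homotopy w) x = homotopy_coef w k x.
Proof. destruct k as [[|] [|]]; reflexivity. Qed.

End Coefficients.

(** * The hypotheses of the homotopy argument for Cech cochains *)

Section CechDeRham.
Variables (L : lattice) (I : Type) (U : I -> elliptic_curve L -> Prop).
Hypothesis U_open : forall i, open_E (U i).
Implicit Types (t : list I) (c : cochain L I) (k : bool * bool) (x : elliptic_curve L).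

Lemma inter_open t : open_E (inter U t).
Proof.
induction t as [| i t IH]; intros z Hz.
- exists (mkposreal 1 Rlt_0_1); intros w _; constructor.
- inversion Hz as [| ? ? H1 H2]; subst.
  eapply filter_imp; [| apply filter_and; [exact (U_open H1) | exact (IH z H2)]].
  intros w [P Q]; constructor; assumption.
Qed.

Lemma inter_face t j x : inter U t x -> inter U (face j t) x.
Proof.
unfold inter, face; rewrite !Forall_forall; intros H i Hi; apply H.
apply in_app_or in Hi; destruct Hi as [Hi | Hi].
- rewrite <- (firstn_skipn j t); apply in_or_app; left; exact Hi.
- rewrite <- (firstn_skipn (S j) t); apply in_or_app; right; exact Hi.
Qed.

Lemma length_face t j : (j < length t)%nat -> length (face j t) = pred (length t).
Proof. intros H; unfold face; rewrite length_app, length_firstn, length_skipn; lia. Qed.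

Lemma coef_cech_in k c t x : inter U t x ->
  coef k (cech_diff U c t) x
  = sum_n (G := C_AbelianGroup) (fun j => alt j (coef k (c (face j t)) x)) (pred (length t)).
Proof.
intros Hx; unfold cech_diff; rewrite coef_restrict_in by exact Hx; rewrite coef_sum.
apply sum_n_ext; intros j; apply coef_alt.
Qed.

Lemma coef_cech_out k c t x : ~ inter U t x -> coef k (cech_diff U c t) x = RtoC 0.
Proof. apply coef_restrict_out. Qed.

Lemma coef_de_rham_in k c t x : inter U t x ->
  coef k (de_rham_diff U c t) x = d_coef (c t) k x.
Proof. intros Hx; unfold de_rham_diff; rewrite coef_restrict_in by exact Hx; apply coef_d_form. Qed.

Lemma coef_de_rham_out k c t x : ~ inter U t x -> coef k (de_rham_diff U c t) x = RtoC 0.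
Proof. apply coef_restrict_out. Qed.

Lemma cochain_ext c c' : (forall t k x, coef k (c t) x = coef k (c' t) x) -> c = c'.
Proof.
intros H; apply functional_extensionality; intros t; apply form_ext; intros k x; apply H.
Qed.

Lemma cech_term_holomorphic p q c t k x :
  cech_term U p q c -> inter U t x -> holomorphic_at (coef k (c t)) x.
Proof.
intros Hc Hx; destruct (Nat.eq_dec (length t) (S q)) as [E | N].
- destruct (proj1 (Omega_iff p (inter U t) (c t)) (proj1 (Hc t) E)) as (H & Z & _); auto.
- rewrite (proj2 (Hc t) N).
  replace (coef k (zero : form L)) with (fun _ : elliptic_curve L => RtoC 0)
    by (apply functional_extensionality; intros y; symmetry; apply coef_zero).
  apply holomorphic_at_const.
Qed.

Lemma cech_term_outside p q c t k x :
  cech_term U p q c -> ~ inter U t x -> coef k (c t) x = RtoC 0.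
Proof.
intros Hc Hx; destruct (Nat.eq_dec (length t) (S q)) as [E | N].
- destruct (proj1 (Omega_iff p (inter U t) (c t)) (proj1 (Hc t) E)) as (H & Z & _); auto.
- rewrite (proj2 (Hc t) N); apply coef_zero.
Qed.

Lemma cech_term_zero p q : cech_term U p q zero.
Proof.
intros t; split; [| reflexivity]; intros _; apply Omega_iff; split; [| split].
- intros k x _; change ((zero : cochain L I) t) with (zero : form L).
  replace (coef k (zero : form L)) with (fun _ : elliptic_curve L => RtoC 0)
    by (apply functional_extensionality; intros y; symmetry; apply coef_zero).
  apply holomorphic_at_const.
- intros k x _; apply coef_zero.
- reflexivity.
Qed.

Lemma cech_term_minus p q c c' :
  cech_term U p q c -> cech_term U p q c' -> cech_term U p q (minus c c').
Proof.
intros H H' t; split.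
- intros E; apply Omega_iff; split; [| split].
  + intros k x Hx; change (minus c c' t) with (minus (c t) (c' t)).
    replace (coef k (minus (c t) (c' t))) with (fun y => coef k (c t) y + - coef k (c' t) y)%C
      by (apply functional_extensionality; intros y; rewrite coef_minus; reflexivity).
    exact (holomorphic_at_plus (cech_term_holomorphic k H Hx)
      (holomorphic_at_opp (cech_term_holomorphic k H' Hx))).
  + intros k x Hx; change (minus c c' t) with (minus (c t) (c' t)); rewrite coef_minus.
    rewrite (cech_term_outside k H Hx), (cech_term_outside k H' Hx); ring.
  + intros Ep; apply snd_form_zero; intros b x; change (minus c c' t) with (minus (c t) (c' t)).
    rewrite coef_minus.
    assert (E1 := proj2 (proj2 (proj1 (H t) E)) Ep); assert (E2 := proj2 (proj2 (proj1 (H' t) E)) Ep).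
    rewrite (proj1 (snd_form_zero _) E1), (proj1 (snd_form_zero _) E2); ring.
- intros N; change (minus c c' t) with (minus (c t) (c' t)).
  rewrite (proj2 (H t) N), (proj2 (H' t) N); apply minus_eq_zero.
Qed.

Lemma alternating_sum_zero n :
  sum_n (G := C_AbelianGroup) (fun j => alt j (RtoC 0)) n = RtoC 0.
Proof.
induction n as [| n IH]; [rewrite sum_O; reflexivity |].
rewrite sum_Sn, IH.
etransitivity; [apply f_equal, (alt_zero C_AbelianGroup) | apply plus_zero_r].
Qed.

Lemma alternating_sum_minus (f g : nat -> C) n :
  sum_n (G := C_AbelianGroup) (fun j => alt j (f j - g j)%C) n
  = (sum_n (G := C_AbelianGroup) (fun j => alt j (f j)) n
     - sum_n (G := C_AbelianGroup) (fun j => alt j (g j)) n)%C.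
Proof.
assert (A : forall j (a b : C), alt (G := C_AbelianGroup) j (a - b)%C
  = (alt (G := C_AbelianGroup) j a - alt (G := C_AbelianGroup) j b)%C).
{ intros j a b; unfold alt; destruct (Nat.even j); [reflexivity |].
  change (- (a - b) = - a - - b)%C; ring. }
induction n as [| n IH]; [rewrite !sum_O; apply A |].
rewrite !sum_Sn, IH, A.
set (a := sum_n _ n); set (b := sum_n _ n).
change (a - b + (alt (G := C_AbelianGroup) (S n) (f (S n)) - alt (G := C_AbelianGroup) (S n) (g (S n)))
  = a + alt (G := C_AbelianGroup) (S n) (f (S n)) - (b + alt (G := C_AbelianGroup) (S n) (g (S n))))%C.
ring.
Qed.

Lemma alternating_sum_opp (f : nat -> C) n :
  sum_n (G := C_AbelianGroup) (fun j => alt j (- f j)%C) n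
  = (- sum_n (G := C_AbelianGroup) (fun j => alt j (f j)) n)%C.
Proof.
pose proof (alternating_sum_minus (fun _ => RtoC 0) f n) as H; rewrite alternating_sum_zero in H.
replace (- sum_n (G := C_AbelianGroup) (fun j => alt j (f j)) n)%C
  with (0 - sum_n (G := C_AbelianGroup) (fun j => alt j (f j)) n)%C by ring.
rewrite <- H; apply sum_n_ext; intros j; f_equal; ring.
Qed.

Lemma cech_diff_minus c c' :
  cech_diff U (minus c c') = minus (cech_diff U c) (cech_diff U c').
Proof.
apply cochain_ext; intros t k x.
change (minus (cech_diff U c) (cech_diff U c') t) with (minus (cech_diff U c t) (cech_diff U c' t)).
rewrite coef_minus; destruct (classic (inter U t x)) as [Hx | Hx].
- rewrite !coef_cech_in by exact Hx; rewrite <- alternating_sum_minus.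
  apply sum_n_ext; intros j; f_equal.
  change (minus c c' (face j t)) with (minus (c (face j t)) (c' (face j t))); apply coef_minus.
- rewrite !coef_cech_out by exact Hx; ring.
Qed.

Lemma de_rham_diff_minus p q c c' : cech_term U p q c -> cech_term U p q c' ->
  de_rham_diff U (minus c c') = minus (de_rham_diff U c) (de_rham_diff U c').
Proof.
intros Hc Hc'; apply cochain_ext; intros t k x.
change (minus (de_rham_diff U c) (de_rham_diff U c') t)
  with (minus (de_rham_diff U c t) (de_rham_diff U c' t)).
rewrite coef_minus; destruct (classic (inter U t x)) as [Hx | Hx];
  [| rewrite !coef_de_rham_out by exact Hx; ring].
rewrite !coef_de_rham_in by exact Hx.
change (minus c c' t) with (minus (c t) (c' t)).
assert (D : forall k', deriv_z (coef k' (minus (c t) (c' t))) x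
  = (deriv_z (coef k' (c t)) x - deriv_z (coef k' (c' t)) x)%C).
{ intros k'.
  replace (coef k' (minus (c t) (c' t))) with (fun y => coef k' (c t) y + - coef k' (c' t) y)%C
    by (apply functional_extensionality; intros y; rewrite coef_minus; reflexivity).
  pose proof (cech_term_holomorphic k' Hc Hx) as h; pose proof (cech_term_holomorphic k' Hc' Hx) as h'.
  rewrite (deriv_z_plus h (holomorphic_at_opp h')), (deriv_z_opp h'); reflexivity. }
destruct k as [[|] [|]]; unfold d_coef; rewrite ?D, ?coef_minus; ring.
Qed.

Lemma de_rham_diff_square p q c : cech_term U p q c ->
  de_rham_diff U (de_rham_diff U c) = zero.
Proof.
intros Hc; apply cochain_ext; intros t k x.
change ((zero : cochain L I) t) with (zero : form L); rewrite coef_zero.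
destruct (classic (inter U t x)) as [Hx | Hx]; [| apply coef_de_rham_out, Hx].
assert (Z : coef (false, true) (de_rham_diff U c t) = fun _ => RtoC 0).
{ apply functional_extensionality; intros y; destruct (classic (inter U t y)) as [Hy | Hy].
  - rewrite coef_de_rham_in by exact Hy; reflexivity.
  - apply coef_de_rham_out, Hy. }
rewrite coef_de_rham_in by exact Hx; destruct k as [[|] [|]]; unfold d_coef.
- rewrite Z; apply deriv_z_const.
- rewrite coef_de_rham_in by exact Hx; unfold d_coef.
  (* The [d(theta)] coefficient of the differential agrees with the [theta] coefficient of [c t]
     only on the intersection, which suffices for its derivative; the two derivatives then
     cancel. *)
  rewrite (deriv_z_ext (V := inter U t) (f := coef (false, true) (c t)));
    [ring | apply inter_open | exact Hx | | eapply cech_term_holomorphic; eassumption].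
  intros y Hy; rewrite coef_de_rham_in by exact Hy; reflexivity.
- reflexivity.
- rewrite Z; reflexivity.
Qed.

Lemma cech_diff_coef_holomorphic p q c t k x : cech_term U p q c -> inter U t x ->
  holomorphic_at (coef k (cech_diff U c t)) x
  /\ deriv_z (coef k (cech_diff U c t)) x
     = sum_n (G := C_AbelianGroup) (fun j => alt j (deriv_z (coef k (c (face j t))) x)) (pred (length t)).
Proof.
intros Hc Hx.
assert (HF : forall j, holomorphic_at (coef k (c (face j t))) x)
  by (intros j; eapply cech_term_holomorphic; [exact Hc | apply inter_face, Hx]).
destruct (alternating_sum_holomorphic (pred (length t)) HF) as [H1 H2].
assert (E : forall y, inter U t y ->
  sum_n (G := C_AbelianGroup) (fun j => alt j (coef k (c (face j t)) y)) (pred (length t))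
  = coef k (cech_diff U c t) y) by (intros y Hy; symmetry; apply coef_cech_in, Hy).
split.
- exact (holomorphic_at_ext (@inter_open t) Hx E H1).
- rewrite <- H2; exact (deriv_z_ext (@inter_open t) Hx E H1).
Qed.

Lemma cech_term_cech_diff p q c : cech_term U p q c -> cech_term U p (S q) (cech_diff U c).
Proof.
intros Hc t; split.
- intros E; apply Omega_iff; split; [| split].
  + intros k x Hx; apply (cech_diff_coef_holomorphic k Hc Hx).
  + intros k x Hx; apply coef_cech_out, Hx.
  + intros Ep; apply snd_form_zero; intros b x.
    destruct (classic (inter U t x)) as [Hx | Hx]; [| apply coef_cech_out, Hx].
    rewrite coef_cech_in by exact Hx.
    rewrite <- (alternating_sum_zero (pred (length t))).
    apply sum_n_ext_loc; intros j Hj; f_equal.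
    assert (El : length (face j t) = S q) by (rewrite length_face; lia).
    exact (proj1 (snd_form_zero _) (proj2 (proj2 (proj1 (Hc (face j t)) El)) Ep) b x).
- intros N; apply form_ext; intros k x; rewrite coef_zero.
  destruct (classic (inter U t x)) as [Hx | Hx]; [| apply coef_cech_out, Hx].
  rewrite coef_cech_in by exact Hx.
  rewrite <- (alternating_sum_zero (pred (length t))).
  apply sum_n_ext_loc; intros j Hj; f_equal.
  rewrite (proj2 (Hc (face j t))); [apply coef_zero |].
  (* For the empty sequence [pred] truncates, but its only face is again empty and so has the wrong
     length. *)
  destruct t as [| i t]; [destruct j; discriminate |].
  rewrite length_face; simpl in *; lia.
Qed.

Lemma cech_diff_de_rham_diff p q c : cech_term U p q c ->
  cech_diff U (de_rham_diff U c) = de_rham_diff U (cech_diff U c).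
Proof.
intros Hc; apply cochain_ext; intros t k x.
destruct (classic (inter U t x)) as [Hx | Hx];
  [| rewrite coef_cech_out, coef_de_rham_out by exact Hx; reflexivity].
rewrite coef_cech_in, coef_de_rham_in by exact Hx.
transitivity (sum_n (G := C_AbelianGroup) (fun j => alt j (d_coef (c (face j t)) k x)) (pred (length t))).
{ apply sum_n_ext; intros j; f_equal; apply coef_de_rham_in, inter_face, Hx. }
pose proof (fun k => proj2 (cech_diff_coef_holomorphic k Hc Hx)) as D.
destruct k as [[|] [|]]; unfold d_coef.
- symmetry; apply D.
- rewrite D, coef_cech_in by exact Hx.
  apply (alternating_sum_minus (fun j => deriv_z (coef (false, false) (c (face j t))) x)
    (fun j => coef (true, true) (c (face j t)) x)).
- apply alternating_sum_zero.
- symmetry; apply coef_cech_in, Hx.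
Qed.

Definition cochain_homotopy c : cochain L I := fun t => homotopy (c t).

Lemma cochain_homotopy_zero : cochain_homotopy zero = zero.
Proof.
apply cochain_ext; intros t k x; unfold cochain_homotopy; rewrite coef_homotopy.
change ((zero : cochain L I) t) with (zero : form L); rewrite coef_zero.
destruct k as [[|] [|]]; unfold homotopy_coef; rewrite ?coef_zero; ring.
Qed.

Lemma cech_term_cochain_homotopy p q c :
  cech_term U (S (S p)) q c -> cech_term U (S p) q (cochain_homotopy c).
Proof.
intros Hc t; split.
- intros E; apply Omega_iff; split; [| split; [| discriminate]].
  + intros k x Hx; unfold cochain_homotopy.
    replace (coef k (homotopy (c t))) with (homotopy_coef (c t) k)
      by (apply functional_extensionality; intros y; symmetry; apply coef_homotopy).
    destruct k as [[|] [|]].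
    * exact (holomorphic_at_opp (cech_term_holomorphic (true, false) Hc Hx)).
    * exact (@holomorphic_at_const L (RtoC 0) x).
    * exact (cech_term_holomorphic (false, false) Hc Hx).
    * exact (@holomorphic_at_const L (RtoC 0) x).
  + intros k x Hx; unfold cochain_homotopy; rewrite coef_homotopy.
    destruct k as [[|] [|]]; unfold homotopy_coef; rewrite ?(cech_term_outside _ Hc Hx); ring.
- intros N; unfold cochain_homotopy; rewrite (proj2 (Hc t) N).
  exact (f_equal (fun c : cochain L I => c t) cochain_homotopy_zero).
Qed.

Lemma cech_diff_cochain_homotopy c :
  cech_diff U (cochain_homotopy c) = cochain_homotopy (cech_diff U c).
Proof.
apply cochain_ext; intros t k x; unfold cochain_homotopy at 2; rewrite coef_homotopy.
destruct (classic (inter U t x)) as [Hx | Hx].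
- rewrite coef_cech_in by exact Hx.
  transitivity (sum_n (G := C_AbelianGroup) (fun j => alt j (homotopy_coef (c (face j t)) k x)) (pred (length t))).
  { apply sum_n_ext; intros j; f_equal; apply coef_homotopy. }
  destruct k as [[|] [|]]; unfold homotopy_coef; rewrite ?coef_cech_in by exact Hx;
    try apply alternating_sum_zero; try reflexivity.
  apply (alternating_sum_opp (fun j => coef (true, false) (c (face j t)) x)).
- rewrite coef_cech_out by exact Hx.
  destruct k as [[|] [|]]; unfold homotopy_coef; rewrite ?coef_cech_out by exact Hx; ring.
Qed.

Lemma de_rham_diff_cochain_homotopy p q c : cech_term U (S (S p)) q c ->
  de_rham_diff U c = zero -> de_rham_diff U (cochain_homotopy c) = c.
Proof.
intros Hc Hd; apply cochain_ext; intros t k x.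
destruct (classic (inter U t x)) as [Hx | Hx];
  [| rewrite coef_de_rham_out, (cech_term_outside k Hc Hx) by exact Hx; reflexivity].
assert (Z : forall k, d_coef (c t) k x = RtoC 0).
{ intros k'; rewrite <- coef_de_rham_in by exact Hx; rewrite Hd; apply coef_zero. }
rewrite coef_de_rham_in by exact Hx; unfold cochain_homotopy.
assert (H : forall k, coef k (homotopy (c t)) = homotopy_coef (c t) k)
  by (intros k'; apply functional_extensionality; intros y; apply coef_homotopy).
destruct k as [[|] [|]]; unfold d_coef; rewrite ?H; unfold homotopy_coef.
- specialize (Z (true, false)); unfold d_coef in Z; apply Ceq_minus in Z; exact Z.
- rewrite deriv_z_const; ring.
- symmetry; exact (Z (false, false)).
- reflexivity.
Qed.

Theorem cech_de_rham_converges_at_page_2 : hodge_de_rham_converges_at_page U 2.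
Proof.
apply contracting_homotopy_converges_at_page_2 with (s := cochain_homotopy).
- exact cech_term_zero.
- exact cech_term_minus.
- exact de_rham_diff_minus.
- intros; apply cech_diff_minus.
- exact de_rham_diff_square.
- exact cech_diff_de_rham_diff.
- exact cech_term_cech_diff.
- exact cech_term_cochain_homotopy.
- exact cochain_homotopy_zero.
- intros; apply cech_diff_cochain_homotopy.
- exact de_rham_diff_cochain_homotopy.
Qed.

End CechDeRham.

(** * A non-trivial class in H^1(E, O) *)

Section Lattices.
Variable L : lattice.

Lemma in_lattice_0 : in_lattice L 0.
Proof. exists 0%Z, 0%Z; ring. Qed.

Lemma in_lattice_minus (a b : C) : in_lattice L a -> in_lattice L b -> in_lattice L (a - b).
Proof.
intros (m & n & ->) (m' & n' & ->); exists (m - m')%Z, (n - n')%Z.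
rewrite !minus_IZR, !RtoC_minus; ring.
Qed.

Lemma in_lattice_opp (a : C) : in_lattice L a -> in_lattice L (- a).
Proof.
intros H; replace (- a)%C with (0 - a)%C by ring; exact (in_lattice_minus in_lattice_0 H).
Qed.

Lemma proj_eq (a b : C) : in_lattice L (a - b) <-> proj L a = proj L b.
Proof.
split.
- intros H; unfold proj.
  assert (E : (fun w => in_lattice L (w - a)%C) = (fun w => in_lattice L (w - b)%C)).
  { apply functional_extensionality; intros w; apply propositional_extensionality; split; intros Hw.
    - replace (w - b)%C with ((w - a) - - (a - b))%C by ring.
      apply in_lattice_minus; [exact Hw | apply in_lattice_opp, H].
    - replace (w - a)%C with ((w - b) - (a - b))%C by ring.
      apply in_lattice_minus; assumption. }
  (* The proof field depends on the coset, so it is generalized before the cosets are identified. *)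
  generalize (ex_intro (fun z => (fun w => in_lattice L (w - a)%C) = (fun w => in_lattice L (w - z)%C)) a eq_refl).
  rewrite E; intros e; f_equal; apply proof_irrelevance.
- intros H; apply (f_equal (@point_coset L)) in H; simpl in H.
  apply (f_equal (fun P => P a)) in H; rewrite <- H.
  replace (a - a)%C with (RtoC 0) by ring; exact in_lattice_0.
Qed.

Lemma lift_proj (z : C) : in_lattice L (lift (proj L z) - z).
Proof. apply proj_eq, proj_lift. Qed.

(* With e i a point outside U i, the differences zeta (z - e j) - zeta (z - e i) are
   elliptic and form a cocycle.  If it is the coboundary of g, then the functions
   zeta (z - e i) - g i glue to an entire function with quasi-periods 0 and +-1. *)
Theorem nontrivial_cocycle (I : Type) (U : I -> elliptic_curve L -> Prop) :
  proper_open_cover U ->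
  exists c : I -> I -> elliptic_curve L -> C,
    (forall i j x, U i x -> U j x -> holomorphic_at (c i j) x) /\
    (forall i j k x, (c j k x - c i k x + c i j x = 0)%C) /\
    ~ exists g : I -> elliptic_curve L -> C,
        (forall i x, U i x -> holomorphic_at (g i) x) /\
        (forall i j x, U i x -> U j x -> c i j x = (g j x - g i x)%C).
Proof.
intros (Hopen & Hproper & Hcover).
destruct (quasi_periodic_function_exists L) as (zeta & s & Hs & Hder & Hper).
set (e i := proj1_sig (constructive_indefinite_description _ (Hproper i))).
assert (He : forall i, ~ U i (e i))
  by (intros i; exact (proj2_sig (constructive_indefinite_description _ (Hproper i)))).
assert (Hoff : forall i z, U i (proj L z) -> ~ in_lattice L (z - lift (e i))).
{ intros i z Hz H; apply proj_eq in H; rewrite proj_lift in H; apply (He i); rewrite <- H; exact Hz. }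
(* As [zeta] is a total function, the cocycle identity holds at every point, also outside the cover
   members involved. *)
set (c := fun (i j : I) (x : elliptic_curve L) =>
  (zeta (lift x - lift (e j)) - zeta (lift x - lift (e i)))%C).
(* Another lift of the point shifts both zeta values by the same quasi-period, which cancels in the
   difference; hence [c] can be computed with any lift. *)
assert (Hc : forall i j z, U i (proj L z) -> U j (proj L z) ->
  c i j (proj L z) = (zeta (z - lift (e j)) - zeta (z - lift (e i)))%C).
{ intros i j z Hi Hj; unfold c; destruct (lift_proj z) as (m & n & E).
  assert (P : forall k, U k (proj L z) ->
    zeta (lift (proj L z) - lift (e k))%C = (zeta (z - lift (e k)) + RtoC (s * IZR n))%C).
  { intros k Hk; rewrite <- (Hper _ m n (Hoff k z Hk)), <- E; f_equal; ring. }
  rewrite !P by assumption; ring. }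
assert (Hz : forall i z, U i (proj L z) -> exists l, Cderiv_at (fun w => zeta (w - lift (e i))%C) z l).
{ intros i z Hi; destruct (Hder _ (Hoff i z Hi)) as [l Hl].
  pose proof (Cderiv_at_affine 1 (- lift (e i)) z) as HA.
  replace (z - lift (e i))%C with (1 * z + - lift (e i))%C in Hl by ring.
  exists (1 * l)%C; eapply Cderiv_at_ext_loc; [| exact (Cderiv_at_comp HA Hl)].
  exists 1; split; [lra |]; intros w _; cbv beta; f_equal; ring. }
assert (Hloc : forall i z, U i (proj L z) ->
  exists delta, 0 < delta /\ forall w, Cmod (w - z) < delta -> U i (proj L w)).
{ intros i z Hi; apply (locally_Cmod (fun w => U i (proj L w))); exact (Hopen i z Hi). }
exists c; split; [| split].
- intros i j x Hi Hj z Ez; subst x; apply ex_C_derive_iff.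
  destruct (Hz i z Hi) as [l Hl]; destruct (Hz j z Hj) as [m Hm].
  exists (m - l)%C; eapply Cderiv_at_ext_loc; [| exact (Cderiv_at_minus Hm Hl)].
  destruct (Hloc i z Hi) as (d1 & P1 & D1); destruct (Hloc j z Hj) as (d2 & P2 & D2).
  exists (Rmin d1 d2); split; [apply Rmin_glb_lt; assumption |].
  intros w Hw; symmetry; apply Hc; [apply D1 | apply D2];
    (eapply Rlt_le_trans; [exact Hw | apply Rmin_l + apply Rmin_r]).
- intros i j k x; unfold c; ring.
- intros (g & Hg & Hcg).
  (* [G] uses an arbitrarily chosen cover member at each point; that all members give the same value
     is where [c] being the coboundary of [g] enters. *)
  set (idx x := proj1_sig (constructive_indefinite_description _ (Hcover x))).
  assert (Hidx : forall x, U (idx x) x)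
    by (intros x; exact (proj2_sig (constructive_indefinite_description _ (Hcover x)))).
  set (G z := (zeta (z - lift (e (idx (proj L z)))) - g (idx (proj L z)) (proj L z))%C).
  assert (HG : forall i z, U i (proj L z) -> G z = (zeta (z - lift (e i)) - g i (proj L z))%C).
  { intros i z Hi; unfold G; set (k := idx (proj L z)).
    assert (Hk : U k (proj L z)) by apply Hidx.
    pose proof (Hc i k z Hi Hk) as E1; rewrite (Hcg i k _ Hi Hk) in E1.
    replace (zeta (z - lift (e k)))%C
      with (zeta (z - lift (e i)) + (zeta (z - lift (e k)) - zeta (z - lift (e i))))%C by ring.
    rewrite <- E1; ring. }
  assert (Gdiff : C_differentiable G).
  { intros z; pose proof (Hidx (proj L z)) as Hi; set (i := idx (proj L z)) in *.
    destruct (Hz i z Hi) as [l Hl].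
    destruct (proj1 (ex_C_derive_iff _ _) (Hg i (proj L z) Hi z eq_refl)) as [m Hm].
    exists (l - m)%C; eapply Cderiv_at_ext_loc; [| exact (Cderiv_at_minus Hl Hm)].
    destruct (Hloc i z Hi) as (d & P & D); exists d; split; [exact P |].
    intros w Hw; symmetry; apply HG, D, Hw. }
  assert (Gper : forall m n z,
    G (z + (RtoC (IZR m) * omega1 L + RtoC (IZR n) * omega2 L))%C = (G z + RtoC (s * IZR n))%C).
  { intros m n z; set (w := (z + (RtoC (IZR m) * omega1 L + RtoC (IZR n) * omega2 L))%C).
    assert (Ew : proj L w = proj L z).
    { apply proj_eq; exists m, n; unfold w; ring. }
    pose proof (Hidx (proj L z)) as Hi; set (i := idx (proj L z)) in *.
    rewrite (HG i w) by (rewrite Ew; exact Hi); rewrite (HG i z Hi), Ew.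
    replace (w - lift (e i))%C with
      (z - lift (e i) + (RtoC (IZR m) * omega1 L + RtoC (IZR n) * omega2 L))%C by (unfold w; ring).
    rewrite Hper by (apply Hoff, Hi); ring. }
  assert (H1 : omega1 L <> 0%C).
  { intro K; destruct (@omega_indep L 1 0) as [E _]; [| lra]; rewrite K; ring. }
  assert (Gu : forall z, G (z + omega1 L)%C = G z).
  { intros z; pose proof (Gper 1%Z 0%Z z) as E.
    rewrite Rmult_0_r, Cplus_0_r in E; rewrite <- E; f_equal; ring. }
  destruct Hs as [-> | ->].
  + apply (no_entire_additive_quasiperiod (v := omega2 L) Gdiff H1 Gu).
    intros z; pose proof (Gper 0%Z 1%Z z) as E.
    rewrite Rmult_1_r in E; rewrite <- E; f_equal; ring.
  (* If the increment along [omega2] is [- 1], it is 1 along [- omega2]. *)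
  + apply (no_entire_additive_quasiperiod (v := (- omega2 L)%C) Gdiff H1 Gu).
    intros z; pose proof (Gper 0%Z (-1)%Z z) as E.
    replace (-1 * -1) with 1 in E by ring; rewrite <- E; f_equal.
    change (-1)%Z with (- (1))%Z; rewrite opp_IZR, RtoC_opp; ring.
Qed.

End Lattices.

(** * Non-zero differentials on page one *)

Section NonzeroClasses.
Variables (L : lattice) (I : Type) (U : I -> elliptic_curve L -> Prop).
Hypothesis U_open : forall i, open_E (U i).

Definition form_cochain (q : nat) (w : list I -> form L) : cochain L I := fun t =>
  if Nat.eqb (length t) (S q) then restrict_form (inter U t) (w t) else zero.

Lemma coef_form_cochain q w t k x : length t = S q -> inter U t x ->
  coef k (form_cochain q w t) x = coef k (w t) x.
Proof.
intros E Hx; unfold form_cochain; rewrite E, Nat.eqb_refl; apply coef_restrict_in, Hx.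
Qed.

Lemma form_cochain_wrong_length q w t : length t <> S q -> form_cochain q w t = zero.
Proof. intros N; unfold form_cochain; apply Nat.eqb_neq in N; rewrite N; reflexivity. Qed.

Lemma coef_form_cochain_out q w t k x : ~ inter U t x ->
  coef k (form_cochain q w t) x = RtoC 0.
Proof.
intros Hx; unfold form_cochain; destruct (Nat.eqb (length t) (S q));
  [apply coef_restrict_out, Hx | apply coef_zero].
Qed.

(** Positive degree leaves the [dz] component unrestricted. *)
Lemma cech_term_form_cochain p q w :
  (forall t k x, length t = S q -> inter U t x -> holomorphic_at (coef k (w t)) x) ->
  cech_term U (S p) q (form_cochain q w).
Proof.
intros H t; split; [| apply form_cochain_wrong_length].
intros E; apply Omega_iff; split; [| split; [| discriminate]].
- intros k x Hx; refine (holomorphic_at_ext (f := coef k (w t)) (inter_open U_open (t := t)) Hx _ _).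
  + intros y Hy; symmetry; apply coef_form_cochain; assumption.
  + apply H; assumption.
- intros k x Hx; apply coef_form_cochain_out, Hx.
Qed.

Lemma cech_diff_form_cochain_zero q w :
  (forall t k x, length t = S (S q) -> inter U t x ->
     sum_n (G := C_AbelianGroup) (fun j => alt j (coef k (w (face j t)) x)) (S q) = RtoC 0) ->
  cech_diff U (form_cochain q w) = zero.
Proof.
intros H; apply cochain_ext; intros t k x.
change ((zero : cochain L I) t) with (zero : form L); rewrite coef_zero.
destruct (classic (inter U t x)) as [Hx | Hx]; [| apply coef_cech_out, Hx].
rewrite coef_cech_in by exact Hx.
destruct (Nat.eq_dec (length t) (S (S q))) as [E | N].
- rewrite <- (H t k x E Hx), E; apply sum_n_ext_loc; intros j Hj; f_equal.
  apply coef_form_cochain; [rewrite length_face; lia | apply inter_face, Hx].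
- rewrite <- (alternating_sum_zero (pred (length t))).
  apply sum_n_ext_loc; intros j Hj; f_equal.
  rewrite form_cochain_wrong_length; [apply coef_zero |].
  destruct t as [| i t]; [destruct j; discriminate |].
  rewrite length_face; simpl in *; lia.
Qed.

Lemma de_rham_diff_form_cochain q w w' :
  (forall t k x, length t = S q -> inter U t x ->
     holomorphic_at (coef k (w t)) x /\ d_coef (w t) k x = coef k (w' t) x) ->
  de_rham_diff U (form_cochain q w) = form_cochain q w'.
Proof.
intros H; apply cochain_ext; intros t k x.
destruct (classic (inter U t x)) as [Hx | Hx];
  [| rewrite coef_de_rham_out, coef_form_cochain_out by exact Hx; reflexivity].
rewrite coef_de_rham_in by exact Hx.
destruct (Nat.eq_dec (length t) (S q)) as [E | N].
- rewrite coef_form_cochain by assumption; rewrite <- (proj2 (H t k x E Hx)).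
  assert (D : forall k', deriv_z (coef k' (form_cochain q w t)) x = deriv_z (coef k' (w t)) x).
  { intros k'; apply (deriv_z_ext (inter_open U_open (t := t)) Hx);
      [intros y Hy; symmetry; apply coef_form_cochain; assumption | apply H; assumption]. }
  destruct k as [[|] [|]]; unfold d_coef; rewrite ?D, ?coef_form_cochain by assumption; reflexivity.
- rewrite !form_cochain_wrong_length by exact N.
  assert (Z : forall k', deriv_z (coef k' (zero : form L)) x = RtoC 0).
  { intros k'; replace (coef k' (zero : form L)) with (fun _ : elliptic_curve L => RtoC 0)
      by (apply functional_extensionality; intros y; symmetry; apply coef_zero).
    apply deriv_z_const. }
  destruct k as [[|] [|]]; unfold d_coef; rewrite ?Z, ?coef_zero; ring.
Qed.

Definition theta_form : form L := (fun _ => (RtoC 0, RtoC 1), fun _ => (RtoC 0, RtoC 0)).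
Definition one_form : form L := (fun _ => (RtoC 1, RtoC 0), fun _ => (RtoC 0, RtoC 0)).

(* In degree p this represents d(theta)^p theta, and one_form represents d(theta)^p. *)
Definition theta_cochain : cochain L I := form_cochain 0 (fun _ => theta_form).

Lemma constant_coef_holomorphic (w : form L) (k : bool * bool) (a : C) (x : elliptic_curve L) :
  (forall y, coef k w y = a) -> holomorphic_at (coef k w) x.
Proof.
intros H; replace (coef k w) with (fun _ : elliptic_curve L => a)
  by (apply functional_extensionality; intros y; symmetry; apply H).
apply holomorphic_at_const.
Qed.

Lemma theta_form_holomorphic k x : holomorphic_at (coef k theta_form) x.
Proof. apply (constant_coef_holomorphic (a := coef k theta_form x)); destruct k as [[|] [|]]; reflexivity. Qed.

Lemma one_form_holomorphic k x : holomorphic_at (coef k one_form) x.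
Proof. apply (constant_coef_holomorphic (a := coef k one_form x)); destruct k as [[|] [|]]; reflexivity. Qed.

(** The pair representing a form does not record its degree, so one cochain gives a class in every
    column [p >= 1]. *)
Lemma cech_term_theta_cochain p : cech_term U (S p) 0 theta_cochain.
Proof. apply cech_term_form_cochain; intros; apply theta_form_holomorphic. Qed.

Lemma cech_diff_theta_cochain : cech_diff U theta_cochain = zero.
Proof.
apply cech_diff_form_cochain_zero; intros t k x _ _.
rewrite sum_Sn, sum_O; exact (Cplus_opp_r (coef k theta_form x)).
Qed.

Lemma de_rham_diff_theta_cochain :
  de_rham_diff U theta_cochain = form_cochain 0 (fun _ => one_form).
Proof.
apply de_rham_diff_form_cochain; intros t k x _ _; split; [apply theta_form_holomorphic |].
destruct k as [[|] [|]]; unfold d_coef; try reflexivity.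
- exact (deriv_z_const (RtoC 1) x).
- change (deriv_z (fun _ : elliptic_curve L => RtoC 0) x - RtoC 0 = RtoC 0)%C.
  rewrite deriv_z_const; ring.
Qed.

Lemma de_rham_diff_theta_cochain_nonzero :
  (forall x, exists i, U i x) -> de_rham_diff U theta_cochain <> zero.
Proof.
intros Hcover H; rewrite de_rham_diff_theta_cochain in H.
destruct (Hcover (proj L 0)) as [i Hi].
assert (Hx : inter U (i :: nil) (proj L 0)) by (constructor; [exact Hi | constructor]).
apply (f_equal (fun c : cochain L I => coef (false, false) (c (i :: nil)) (proj L 0))) in H.
rewrite coef_form_cochain in H by (reflexivity || exact Hx).
change (RtoC 1 = RtoC 0) in H; apply RtoC_inj in H; lra.
Qed.

Lemma cech_term_de_rham_diff_theta_cochain p :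
  cech_term U (S p) 0 (de_rham_diff U theta_cochain).
Proof.
rewrite de_rham_diff_theta_cochain; apply cech_term_form_cochain.
intros; apply one_form_holomorphic.
Qed.

Lemma page_1_differential_row_0 p : (forall x, exists i, U i x) -> d1_nonzero U (S p) 0.
Proof.
intros Hcover; apply d1_nonzero_of_class with (x := theta_cochain).
- exact (@cech_term_zero L I U).
- exact (@cech_term_minus L I U).
- exact (@de_rham_diff_minus L I U).
- intros; apply cech_diff_minus.
- apply cech_term_theta_cochain.
- apply cech_diff_theta_cochain.
- apply cech_term_de_rham_diff_theta_cochain.
- apply de_rham_diff_theta_cochain_nonzero, Hcover.
Qed.

Lemma not_converges_at_page_1 :
  (forall x, exists i, U i x) -> ~ hodge_de_rham_converges_at_page U 1.
Proof.
intros Hcover; apply not_converges_at_page_1_of_class with (p := O) (x := theta_cochain).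
- exact (@cech_term_zero L I U).
- exact (@cech_term_minus L I U).
- exact (@de_rham_diff_minus L I U).
- intros; apply cech_diff_minus.
- exact (@de_rham_diff_square L I U U_open).
- apply cech_term_theta_cochain.
- apply cech_diff_theta_cochain.
- apply cech_term_de_rham_diff_theta_cochain.
- apply de_rham_diff_theta_cochain_nonzero, Hcover.
Qed.

(** * Row one, from a 1-cocycle that is not a coboundary *)

Section RowOne.
Variable c : I -> I -> elliptic_curve L -> C.
Hypothesis c_holomorphic : forall i j x, U i x -> U j x -> holomorphic_at (c i j) x.
Hypothesis c_cocycle : forall i j k x, (c j k x - c i k x + c i j x = 0)%C.

Definition pair_function (t : list I) : elliptic_curve L -> C :=
  match t with i :: j :: nil => c i j | _ => fun _ => RtoC 0 end.

Lemma pair_function_holomorphic t x : inter U t x -> holomorphic_at (pair_function t) x.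
Proof.
intros Hx; destruct t as [| i [| j [| k t]]]; try (exact (@holomorphic_at_const L (RtoC 0) x)).
inversion Hx as [| ? ? Hi H]; inversion H as [| ? ? Hj _]; subst.
exact (c_holomorphic Hi Hj).
Qed.

Definition dz_theta_form (t : list I) : form L :=
  (fun _ => (RtoC 0, RtoC 0), fun x => (RtoC 0, pair_function t x)).

Definition minus_dz_form (t : list I) : form L :=
  (fun _ => (RtoC 0, RtoC 0), fun x => (- pair_function t x, RtoC 0)%C).

Lemma dz_theta_form_holomorphic t k x : inter U t x -> holomorphic_at (coef k (dz_theta_form t)) x.
Proof.
intros Hx; destruct k as [[|] [|]]; try exact (@holomorphic_at_const L (RtoC 0) x).
exact (pair_function_holomorphic Hx).
Qed.

Lemma minus_dz_form_holomorphic t k x : inter U t x -> holomorphic_at (coef k (minus_dz_form t)) x.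
Proof.
intros Hx; destruct k as [[|] [|]]; try exact (@holomorphic_at_const L (RtoC 0) x).
exact (holomorphic_at_opp (pair_function_holomorphic Hx)).
Qed.

(* The class dz d(theta)^(p-1) theta c has the advantage over d(theta)^p theta c
   that no derivative of c occurs in its differential. *)
Lemma de_rham_diff_dz_theta :
  de_rham_diff U (form_cochain 1 dz_theta_form) = form_cochain 1 minus_dz_form.
Proof.
apply de_rham_diff_form_cochain; intros t k x _ Hx; split; [apply dz_theta_form_holomorphic, Hx |].
destruct k as [[|] [|]]; unfold d_coef; try reflexivity.
- exact (deriv_z_const (RtoC 0) x).
- change (deriv_z (fun _ : elliptic_curve L => RtoC 0) x - pair_function t x = - pair_function t x)%C.
  rewrite deriv_z_const; ring.
Qed.

Lemma cech_diff_dz_theta : cech_diff U (form_cochain 1 dz_theta_form) = zero.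
Proof.
apply cech_diff_form_cochain_zero; intros t k x E Hx.
destruct t as [| i [| j [| l [| m t]]]]; try discriminate.
rewrite !sum_Sn, sum_O.
destruct k as [[|] [|]].
2,3,4: change (RtoC 0 + - RtoC 0 + RtoC 0 = RtoC 0)%C; ring.
change (c j l x + - c i l x + c i j x = RtoC 0)%C.
exact (c_cocycle i j l x).
Qed.

(** If the differential were the Cech coboundary of a 0-cochain [h] of forms, the [dz] coefficient
    of [h] would be a primitive of [- c]; hence the sign in the witness. *)
Lemma page_1_differential_row_1 p :
  ~ (exists g : I -> elliptic_curve L -> C,
       (forall i x, U i x -> holomorphic_at (g i) x) /\
       (forall i j x, U i x -> U j x -> c i j x = (g j x - g i x)%C)) ->
  d1_nonzero U (S p) 1.
Proof.
intros Hn; apply d1_nonzero_of_class with (x := form_cochain 1 dz_theta_form).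
- exact (@cech_term_zero L I U).
- exact (@cech_term_minus L I U).
- exact (@de_rham_diff_minus L I U).
- intros; apply cech_diff_minus.
- apply cech_term_form_cochain; intros; apply dz_theta_form_holomorphic; assumption.
- exact cech_diff_dz_theta.
- rewrite de_rham_diff_dz_theta; apply cech_term_form_cochain.
  intros; apply minus_dz_form_holomorphic; assumption.
- intros (h & Hh & E); apply Hn.
  exists (fun i x => (- coef (true, false) (h (i :: nil)) x)%C); split.
  + intros i x Hi.
    assert (Hx : inter U (i :: nil) x) by (constructor; [exact Hi | constructor]).
    exact (holomorphic_at_opp (cech_term_holomorphic (true, false) Hh Hx)).
  + intros i j x Hi Hj.
    assert (Hx : inter U (i :: j :: nil) x) by (repeat constructor; assumption).
    rewrite de_rham_diff_dz_theta in E.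
    apply (f_equal (fun c : cochain L I => coef (true, false) (c (i :: j :: nil)) x)) in E.
    rewrite coef_form_cochain in E by (reflexivity || exact Hx).
    rewrite coef_cech_in in E by exact Hx.
    change (pred (length (i :: j :: nil))) with 1%nat in E; rewrite sum_Sn, sum_O in E.
    change (- c i j x = coef (true, false) (h (j :: nil)) x
                        + - coef (true, false) (h (i :: nil)) x)%C in E.
    replace (c i j x) with (- - c i j x)%C by ring; rewrite E; ring.
Qed.

End RowOne.

End NonzeroClasses.

(** * The flat Kaehler metric and the Gaussian lattice *)

Lemma continuously_differentiable_const (n : nat) (a : R) :
  continuously_differentiable n (fun _ _ => a).
Proof.
revert a; induction n as [| n IH]; intros a; simpl.
- intros x y; apply continuity_2d_pt_const.
- split; [intros x y; split; apply ex_derive_const |].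
  assert (D : forall x, Derive (fun _ : R => a) x = 0) by (intros x; apply Derive_const).
  split.
  + replace (fun x y : R => Derive (fun _ => a) x) with (fun _ _ : R => 0); [apply IH |].
    apply functional_extensionality; intros x; apply functional_extensionality; intros y.
    symmetry; apply D.
  + replace (fun x y : R => Derive (fun _ => a) y) with (fun _ _ : R => 0); [apply IH |].
    apply functional_extensionality; intros x; apply functional_extensionality; intros y.
    symmetry; apply D.
Qed.

Lemma gaussian_independent (a b : R) : (RtoC a * 1 + RtoC b * Ci = 0)%C -> a = 0 /\ b = 0.
Proof.
intros H; apply (f_equal (fun z : C => (Re z, Im z))) in H.
unfold Re, Im, Ci, RtoC in H; simpl in H; injection H; intros; lra.
Qed.

Theorem mainTheorem4 :
  (forall (L : lattice) (I : Type) (U : I -> elliptic_curve L -> Prop),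
     proper_open_cover U ->
     (forall N : nat, exists p : nat, (N <= p)%nat /\ d1_nonzero U p 0)
     /\ (forall N : nat, exists p : nat, (N <= p)%nat /\ d1_nonzero U p 1)
     /\ ~ hodge_de_rham_converges_at_page U 1
     /\ hodge_de_rham_converges_at_page U 2)
  /\
  (exists L : lattice,
     (exists h : elliptic_curve L -> R, kaehler_metric h)
     /\ forall (I : Type) (U : I -> elliptic_curve L -> Prop),
          proper_open_cover U -> ~ hodge_de_rham_converges_at_page U 1).
Proof.
split.
- intros L I U HU; pose proof HU as (Hopen & _ & Hcover).
  split; [| split; [| split]].
  (* The explicit classes live in positive degree, and [S N] is both positive and at least [N]. *)
  + intros N; exists (S N); split; [lia | apply page_1_differential_row_0; assumption].
  + intros N; exists (S N); split; [lia |].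
    destruct (nontrivial_cocycle HU) as (c & Hc1 & Hc2 & Hc3).
    exact (page_1_differential_row_1 Hopen Hc1 Hc2 N Hc3).
  + apply not_converges_at_page_1; assumption.
  + apply cech_de_rham_converges_at_page_2; assumption.
- exists (Lattice gaussian_independent); split.
  + exists (fun _ => 1); split; [intros; lra |].
    intros n; exact (continuously_differentiable_const n 1).
  + intros I U (Hopen & _ & Hcover); apply not_converges_at_page_1; assumption.
Qed.
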